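(* For each $n\in\mathbb N$ let $M=M_n\ge 1$ be an integer, where $M_n/n\not\to 0$ as $n\to\infty$. Let $p_M=(p_{M1},\dots,p_{MM})$ be a vector of nonnegative numbers with $\sum_{i=1}^M p_{Mi}=1$, and let $X=(X_1,\dots,X_M)$ be a multinomial$(n,p_M)$ random vector. Let $k=k_n>0$ be a bandwidth depending on $n$ and let $w$ be a probability density on $\mathbb R$. Define $$g_M(u)=\sum_{i=1}^M M p_{Mi}\,\mathbf 1_{(\frac{i-1}{M},\frac{i}{M}]}(u),\quad u\in\mathbb R,$$ and $$\hat F_M(x)=\frac1M\sum_{j=1}^M \mathbf 1\Big[\frac{M}{nk}\sum_{i=1}^M w\Big(\frac{j-i}{k}\Big)X_i\le x\Big].$$ Suppose that, as $n\to\infty$, $k\to\infty$, $k/M\to 0$ and $M/(nk)\to 0$; that $w$ is Riemann integrable on bounded intervals, is also Riemann square integrable on bounded intervals, and has bounded support or is ultimately monotone in its tails; and that $$\sup_{0<u\le 1}|g_M(u)-g(u)|\to 0$$ for a limiting parent density $g$ that is continuous on $[0,1]$. Let $F$ be the distribution function of $g(U)$, where $U$ is uniformly distributed on $(0,1)$. Then, as $n\to\infty$, $\hat F_M\stackrel{w}{\to}F$ in probability.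
   Context: The number of cells $M=M_n$, the vector $p_M$, and the bandwidth $k=k_n$ depend on $n$, while the kernel $w$ is fixed; all limits are as $n\to\infty$. $\mathbf 1[A]$ is the indicator of the event $A$ and $\mathbf 1_B(u)$ is the indicator function of the set $B$. ''Riemann square integrable on bounded intervals'' means that $w^2$ is Riemann integrable on every bounded interval. ''Ultimately monotone in its tails'' means that there is $K_0>0$ such that $w$ is monotone on $(-\infty,-K_0]$ and on $[K_0,\infty)$. The step function $g_M$ is called the parent density of $p_M$; a limiting parent density is a probability density $g$ on $[0,1]$ that is the limit of $g_M$ in the sense stated in the claim. The structural distribution function of $p_M$ is $F_M(x)=\frac1M\sum_{i=1}^M\mathbf 1[Mp_{Mi}\le x]$, which is the distribution function of $g_M(U)$ with $U$ uniform on $(0,1)$; $F$ denotes its weak limit, which under the uniform convergence of $g_M$ to $g$ is the distribution function of $g(U)$, i.e. $F(x)=P(g(U)\le x)$. For (random) distribution functions $\hat F_M$, ''$\hat F_M\stackrel{w}{\to}F$ in probability'' means: for all $\epsilon>0$ and all continuity points $x_0$ of $F$, $P(|\hat F_M(x_0)-F(x_0)|>\epsilon)\to 0$. *)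

(* Defs.v *)
From HB Require Import structures.
From mathcomp Require Import all_boot all_order all_algebra.
From mathcomp Require Import all_classical all_reals all_analysis.

Set Implicit Arguments.
Unset Strict Implicit.
Unset Printing Implicit Defensive.

Import Order.TTheory GRing.Theory Num.Theory.
Import numFieldNormedType.Exports.

Local Open Scope classical_set_scope.
Local Open Scope ring_scope.

(* Probability density with respect to Lebesgue measure on the Borel set D. *)
Definition is_density (R : realType) (D : set R) (f : R -> R) : Prop :=
  [/\ measurable_fun D f,
      forall x, D x -> 0 <= f x &
      (\int[@lebesgue_measure R]_(x in D) (f x)%:E = 1)%E].

(* The points of the partition are a :: s; the cell number i has left end
   nth b (a :: s) i, right end nth b s i, and tag xi i. *)
Definition riemann_sum (R : realType) (f : R -> R) (a b : R) (s : seq R)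
    (xi : nat -> R) : R :=
  \sum_(i < size s) f (xi i) * (nth b s i - nth b (a :: s) i).

Definition riemann_integrable (R : realType) (f : R -> R) (a b : R) : Prop :=
  exists I : R, forall eps : R, 0 < eps -> exists2 delta : R, 0 < delta &
    forall (s : seq R) (xi : nat -> R), itv_partition a b s ->
      (forall i, (i < size s)%N ->
         nth b s i - nth b (a :: s) i < delta /\
         nth b (a :: s) i <= xi i <= nth b s i) ->
      `|riemann_sum f a b s xi - I| < eps.

Definition bounded_support (R : realType) (f : R -> R) : Prop :=
  exists K : R, forall x, K < `|x| -> f x = 0.

Definition monotone_on (R : realType) (A : set R) (f : R -> R) : Prop :=
  (forall x y, A x -> A y -> x <= y -> f x <= f y) \/
  (forall x y, A x -> A y -> x <= y -> f y <= f x).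

Definition ultimately_monotone (R : realType) (f : R -> R) : Prop :=
  exists2 K0 : R, 0 < K0 &
    monotone_on `]-oo, - K0] f /\ monotone_on `[K0, +oo[ f.

Definition multinomial_pmf (R : realType) (n M : nat) (p : 'I_M -> R)
    (x : 'I_M -> nat) : R :=
  if (\sum_(i < M) x i)%N == n then
    n`!%:R / (\prod_(i < M) (x i)`!%:R) * \prod_(i < M) p i ^+ x i
  else 0.

Definition is_multinomial (R : realType) (d : measure_display)
    (T : measurableType d) (P : probability T R) (n M : nat) (p : 'I_M -> R)
    (X : 'I_M -> {RV P >-> nat}) : Prop :=
  forall x : 'I_M -> nat,
    P [set t | forall i, X i t = x i] = (multinomial_pmf n p x)%:E.

(* Cells are numbered from 0: the ordinal i stands for the cell i.+1 of the
   usual numbering 1, ..., M. *)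
Definition parent_density (R : realType) (M : nat) (p : 'I_M -> R) (u : R)
    : R :=
  \sum_(i < M) M%:R * p i * \1_(`]i%:R / M%:R, i.+1%:R / M%:R]%classic : set R) u.

(* The 0-based numbering does not affect the differences j - i. *)
Definition kernel_df (R : realType) (w : R -> R) (k : R) (n M : nat)
    (X : 'I_M -> nat) (x : R) : R :=
  M%:R^-1 * \sum_(j < M)
    (M%:R / (n%:R * k) * \sum_(i < M) w ((j%:R - i%:R) / k) * (X i)%:R
       <= x)%R%:R.

(* Distribution function of g(U) for U uniform on (0, 1); intersecting with
   the open interval makes the values of g outside it irrelevant. *)
Definition uniform_image_df (R : realType) (g : R -> R) (x : R) : R :=
  fine (uniform_prob (@ltr01 R) (`]0, 1[ `&` [set u | g u <= x])).

Definition weak_cvg_in_probability (R : realType) (d : nat -> measure_display)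
    (T : forall n, measurableType (d n)) (P : forall n, probability (T n) R)
    (Fhat : forall n, T n -> R -> R) (F : R -> R) : Prop :=
  forall (eps x0 : R), 0 < eps -> {for x0, continuous F} ->
    P n [set t | eps < `|Fhat n t x0 - F x0|] @[n --> \oo] --> 0%E.

(* Main.v *)
Require Import Defs.
From HB Require Import structures.
From mathcomp Require Import all_boot all_order all_algebra.
From mathcomp Require Import all_classical all_reals all_analysis.
From mathcomp Require Import measurable_realfun zify ring lra.

Set Implicit Arguments.
Unset Strict Implicit.
Unset Printing Implicit Defensive.

Import Order.TTheory GRing.Theory Num.Theory.
Import numFieldNormedType.Exports.

Local Open Scope classical_set_scope.
Local Open Scope ring_scope.

(** The smoothed count at cell j is [Z_j = M/(nk) * sum_i w((j-i)/k) X_i].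

    Its variance is small.  A linear statistic [sum_i a_i X_i] of a multinomial
    vector is a sum of n independent draws, so its variance is at most
    [n * sum_i p_i a_i^2]; since w and [M p_i] are bounded, this gives
    [Var Z_j <= C * M/(nk) * sum_i w((j-i)/k)/k], and the last sum is bounded
    ([draw_mean_square_le], [kernel_mean_square_le], [kernel_sum_bounded]).

    Its mean is close to g.  We have
    [E Z_j = sum_i w((j-i)/k)/k * (M p_i)], where [M p_i] is uniformly close to
    [g((i+1)/M)].  The weights are values of w on the grid of step 1/k: on a
    bounded window their sum is a Riemann sum of w, and outside it the monotone
    tails of w are dominated by its integral, so the total weight tends to 1
    and concentrates on [|i-j| <= A k] ([half_line_sum_near],
    [kernel_sum_near]).  As [k/M] tends to 0, g is almost constant on such a
    window, hence [E Z_j] is close to [g((j+1)/M)] for every j farther than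
    [A k] from the ends, a set that contains almost all cells
    ([kernel_bias_le], [sum_boundary]).

    So, up to a proportion of cells whose mean is controlled by Chebyshev's
    inequality, the indicator of [Z_j <= x] lies between the indicators of
    [g((j+1)/M) <= x - 2 eta] and of [g((j+1)/M) <= x + 2 eta]
    ([count_deviation]).  Averages of the latter are squeezed between values of
    F at points near x by uniform continuity of g
    ([uniform_image_df_le_count], [count_le_uniform_image_df]), and F is
    continuous at x.

    The law of X enters only through [draw_mean], the expectation of a function
    of n successive draws, which turns all moment computations into inductions
    on n; [multinomial_prob_le] transfers the bounds to the probability P.
    Likewise the density w enters only through its distribution function W and
    the fact that increments of W are controlled by bounds on w. *)

(** * Moments of a multinomial vector *)

Section Draws.
Variables (R : realType) (M : nat) (p : 'I_M -> R).

(** Expectation of [h] applied to the vector of counts of n independent draws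
    with law p, by conditioning on one draw at a time. *)
Fixpoint draw_mean (n : nat) (h : ('I_M -> nat) -> R) : R :=
  if n is m.+1 then
    \sum_(i < M) p i * draw_mean m (fun x => h (fun l => (x l + (l == i))%N))
  else h (fun=> 0%N).

Lemma draw_mean_sum (I : Type) (r : seq I) (F : I -> ('I_M -> nat) -> R) n :
  draw_mean n (fun x => \sum_(y <- r) F y x) =
  \sum_(y <- r) draw_mean n (F y).
Proof.
elim: n F => [//|n IHn] F /=.
rewrite exchange_big; apply: eq_bigr => i _ /=.
by rewrite IHn mulr_sumr.
Qed.

Lemma draw_meanZ (c : R) h n :
  draw_mean n (fun x => c * h x) = c * draw_mean n h.
Proof.
elim: n h => [//|n IHn] h /=.
rewrite mulr_sumr; apply: eq_bigr => i _.
by rewrite IHn mulrCA.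
Qed.

Lemma ler_draw_mean n (h1 h2 : ('I_M -> nat) -> R) :
  (forall i, 0 <= p i) ->
  (forall x, (forall i, x i <= n)%N -> h1 x <= h2 x) ->
  draw_mean n h1 <= draw_mean n h2.
Proof.
move=> p0; elim: n h1 h2 => [|n IHn] h1 h2 h12 /=; first exact: h12.
apply: ler_sum => i _; apply: ler_wpM2l => //.
apply: IHn => x xn; apply: h12 => l.
by rewrite -[n.+1]addn1 leq_add ?leq_b1.
Qed.

Hypothesis p1 : \sum_(i < M) p i = 1.

Lemma draw_mean_cst (c : R) n : draw_mean n (fun=> c) = c.
Proof.
by elim: n => //= n IHn; rewrite IHn -mulr_suml p1 mul1r.
Qed.

(** Adding one draw shifts the centered statistic by [a i - mu], whose p-mean
    is 0, so no cross term survives.  The shift c makes the induction go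
    through: it absorbs the contribution of the last draw. *)
Lemma draw_mean_square (a : 'I_M -> R) (mu : R) n c :
  mu = \sum_(i < M) p i * a i ->
  draw_mean n (fun x => (\sum_(i < M) a i * (x i)%:R - n%:R * mu + c) ^+ 2) =
  n%:R * (\sum_(i < M) p i * (a i - mu) ^+ 2) + c ^+ 2.
Proof.
move=> muE; elim: n c => [|n IHn] c /=.
  rewrite (eq_bigr (fun=> 0)) => [|i _]; last by rewrite mulr0.
  by rewrite big1_eq !mul0r subr0 !add0r.
under eq_bigr => i _.
  have -> : (fun x : 'I_M -> nat =>
      (\sum_(l < M) a l * (x l + (l == i))%N%:R - n.+1%:R * mu + c) ^+ 2) =
      (fun x => (\sum_(l < M) a l * (x l)%:R - n%:R * mu
                 + (c + (a i - mu))) ^+ 2).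
    apply/funext => x; congr (_ ^+ 2).
    rewrite (eq_bigr (fun l => a l * (x l)%:R + a l * (l == i)%:R)); last first.
      by move=> l _; rewrite natrD mulrDr.
    have aiE : \sum_(l < M) a l * (l == i)%:R = a i.
      rewrite (bigD1 i) //= eqxx mulr1 big1 ?addr0 // => l /negPf ->.
      by rewrite mulr0.
    by rewrite big_split /= aiE -natr1; ring.
  rewrite IHn.
  over.
set s := \sum_(i < M) p i * (a i - mu) ^+ 2.
have -> : \sum_(i < M) p i * (n%:R * s + (c + (a i - mu)) ^+ 2) =
   (n%:R * s + c ^+ 2 - 2 * c * mu) * (\sum_(i < M) p i) + 2 * c * (\sum_(i < M) p i * a i) +
   s.
  rewrite !mulr_sumr -!big_split /=; apply: eq_bigr => i _; ring.
by rewrite p1 -muE -natr1; ring.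
Qed.

Lemma draw_mean_square_le (a : 'I_M -> R) (mu : R) n :
  mu = \sum_(i < M) p i * a i ->
  draw_mean n (fun x => (\sum_(i < M) a i * (x i)%:R - n%:R * mu) ^+ 2) <=
  n%:R * (\sum_(i < M) p i * a i ^+ 2).
Proof.
move=> muE; have := @draw_mean_square a mu n 0 muE.
rewrite expr0n /= addr0.
under [X in draw_mean _ X]eq_fun => x do rewrite addr0.
move=> ->; apply: ler_wpM2l => //.
have -> : \sum_(i < M) p i * (a i - mu) ^+ 2 =
    (\sum_(i < M) p i * a i ^+ 2) - 2 * mu * (\sum_(i < M) p i * a i) + mu ^+ 2 * \sum_(i < M) p i.
  rewrite !mulr_sumr -sumrN -!big_split /=; apply: eq_bigr => i _; ring.
rewrite p1 -muE.
have := sqr_ge0 mu; nra.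
Qed.

(** Classify the outcomes of n+1 draws by the value of one of them; in terms of
    multinomial coefficients this is Pascal's rule. *)
Lemma multinomial_pmfS n (y : 'I_M -> nat) :
  multinomial_pmf n.+1 p y =
  \sum_(i < M) (if (0 < y i)%N then
     p i * multinomial_pmf n p (fun l => (y l - (l == i))%N) else 0).
Proof.
have sumB i : (0 < y i)%N ->
    (\sum_(l < M) (y l - (l == i)) = (\sum_(l < M) y l).-1)%N.
  move=> yi; rewrite (bigD1 i) //= [in RHS](bigD1 i) //= eqxx subn1.
  under eq_bigr => l /negPf -> do rewrite subn0.
  by case: (y i) yi.
rewrite /multinomial_pmf; case: ifPn => [/eqP syn|syn]; last first.
  rewrite big1 // => i _; case: ifPn => // yi; rewrite sumB //.
  case: eqP; rewrite ?mulr0 // => sy; case/negP: syn; rewrite -sy prednK //.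
  by rewrite (bigD1 i) //= addn_gt0 yi.
pose c : R := n`!%:R / (\prod_(l < M) (y l)`!%:R) * \prod_(l < M) p l ^+ y l.
transitivity (\sum_(i < M) (y i)%:R * c).
  by rewrite -mulr_suml -natr_sum syn factS natrM /c; ring.
apply: eq_bigr => i _.
case: ifPn => [yi|]; last by rewrite -eqn0Ngt => /eqP ->; rewrite mul0r.
rewrite sumB // syn eqxx.
have pE : \prod_(l < M) p l ^+ y l = p i * \prod_(l < M) p l ^+ (y l - (l == i)).
  rewrite (bigD1 i) //= [in RHS](bigD1 i) //= eqxx mulrA -exprS subn1 prednK //.
  by congr (_ * _); apply: eq_bigr => l /negPf ->; rewrite subn0.
have fE : \prod_(l < M) ((y l)`!%:R : R) =
    (y i)%:R * \prod_(l < M) ((y l - (l == i))`!%:R : R).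
  rewrite (bigD1 i) //= [in RHS](bigD1 i) //= eqxx mulrA -natrM subn1.
  rewrite -{1 2}(prednK yi) factS prednK //.
  by congr (_ * _); apply: eq_bigr => l /negPf ->; rewrite subn0.
rewrite /c fE pE.
have yi0 : (y i)%:R != 0 :> R by rewrite pnatr_eq0 -lt0n.
have f0 : \prod_(l < M) ((y l - (l == i))`!%:R : R) != 0.
  by apply/prodf_neq0 => l _; rewrite pnatr_eq0 -lt0n fact_gt0.
by field; rewrite f0 yi0.
Qed.

Lemma draw_mean_pmf n (y : 'I_M -> nat) :
  draw_mean n (fun x => [forall i, x i == y i]%:R) = multinomial_pmf n p y.
Proof.
elim: n y => [|n IHn] y /=.
  have [/forallP y0|/forallPn[i yi]] := boolP [forall i, 0%N == y i].
    have y0E i : y i = 0%N by rewrite (eqP (y0 i)).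
    rewrite /multinomial_pmf big1 // eqxx fact0.
    by rewrite !big1 ?divr1 ?mulr1 // => i _; rewrite y0E.
  rewrite /multinomial_pmf ifN // -lt0n (bigD1 i) //= addn_gt0 lt0n eq_sym.
  by rewrite yi.
rewrite multinomial_pmfS; apply: eq_bigr => i _.
case: ifPn => [yi|yi].
  rewrite -IHn; congr (_ * draw_mean _ _); apply/funext => x.
  congr (nat_of_bool _)%:R; apply: eq_forallb => l.
  case: (eqVneq l i) => [->|_]; last by rewrite addn0 subn0.
  by rewrite addn1 subn1 -{1}(prednK yi) eqSS.
rewrite -[RHS](mulr0 (p i)); congr (_ * _).
rewrite -[RHS](draw_mean_cst 0 n); congr draw_mean; apply/funext => x.
case: forallP => // /(_ i); rewrite eqxx addn1.
by move: yi; rewrite -eqn0Ngt => /eqP ->.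
Qed.
End Draws.

Section Transfer.
Variables (R : realType) (d : measure_display) (T : measurableType d).
Variables (P : probability T R) (n M : nat) (p : 'I_M -> R).
Variable X : 'I_M -> {RV P >-> nat}.
Hypothesis p0 : forall i, 0 <= p i.
Hypothesis p1 : \sum_(i < M) p i = 1.
Hypothesis X_multinomial : is_multinomial n p X.

(** The counts of n draws are at most n, so only finitely many vectors
    matter. *)
Lemma draw_mean_expand (Q : pred ('I_M -> nat)) :
  draw_mean p n (fun x => (Q x)%:R) =
  \sum_(y : {ffun 'I_M -> 'I_n.+1} | Q (fun i => y i : nat))
     multinomial_pmf n p (fun i => y i : nat).
Proof.
rewrite big_mkcond /=.
transitivity (draw_mean p n (fun x => \sum_(y : {ffun 'I_M -> 'I_n.+1})
   (Q (fun i => y i : nat))%:R * [forall i, x i == y i]%:R)); last first.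
  rewrite draw_mean_sum; apply: eq_bigr => y _.
  by rewrite draw_meanZ draw_mean_pmf //; case: ifP; rewrite ?mul1r ?mul0r.
suff eqQ x : (forall i, x i <= n)%N ->
   (Q x)%:R = \sum_(y : {ffun 'I_M -> 'I_n.+1})
     (Q (fun i => y i : nat))%:R * [forall i, x i == y i]%:R :> R.
  by apply/le_anti/andP; split; apply: ler_draw_mean => // x /eqQ ->.
move=> xn; pose y0 : {ffun 'I_M -> 'I_n.+1} := [ffun i => inord (x i)].
have y0E i : y0 i = x i :> nat by rewrite ffunE inordK // ltnS.
have y0F : (fun i => y0 i : nat) = x by apply/funext.
rewrite (bigD1 y0) //= y0F big1 ?addr0 => [|y yy0].
  by case: forallP => [|[]]; rewrite ?mulr1 // => i; rewrite y0E.
case: forallP => [xy|]; last by rewrite mulr0.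
by case/eqP: yy0; apply/ffunP => i; apply/val_inj; rewrite /= y0E (eqP (xy i)).
Qed.

(** The probabilities of the finitely many vectors with entries at most n add
    up to 1, so the event that X is none of them is negligible. *)
Lemma multinomial_prob_le (Q : pred ('I_M -> nat)) :
  (P [set t | Q (fun i => X i t)] <= (draw_mean p n (fun x => (Q x)%:R))%:E)%E.
Proof.
pose Y := {ffun 'I_M -> 'I_n.+1}.
pose E (y : 'I_M -> nat) : set T := [set t | forall i, X i t = y i].
have mE y : measurable (E y).
  have -> : E y = \bigcap_(i in [set: 'I_M]) (X i @^-1` [set y i]).
    by apply/seteqP; split=> [t Ey i _|t Ey i]; exact: Ey.
  apply: fin_bigcap_measurable => // i _.
  by apply: measurable_funPTI.
pose U (s : pred Y) := \bigcup_(y in [set` [seq y <- enum Y | s y]]) E (fun i => y i : nat).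
have PU s : P (U s) = (\sum_(y : Y | s y) multinomial_pmf n p (fun i => y i : nat))%:E.
  have us : uniq [seq y <- enum Y | s y] by rewrite filter_uniq ?enum_uniq.
  rewrite measure_fin_bigcup //.
    rewrite -(fsbig_seq _ _ us) big_filter big_enum_cond /=.
    by rewrite -sumEFin; apply: eq_bigr => y _; rewrite X_multinomial.
  move=> y z _ _ [t [ty tz]]; apply/ffunP => i; apply/val_inj => /=.
  by rewrite -ty -tz.
have mU s : measurable (U s) by apply: fin_bigcup_measurable.
have mQ : measurable [set t | Q (fun i => X i t)].
  have -> : [set t | Q (fun i => X i t)] =
     \bigcup_(y : {ffun 'I_M -> nat}) (if Q y then E y else set0).
    apply/seteqP; split=> [t /= Qt|t [y _]].
      exists [ffun i => X i t] => //.
      have -> : [ffun i => X i t] = (fun i => X i t) :> (_ -> _).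
        by apply/funext => i; rewrite ffunE.
      by rewrite Qt.
    case: ifP => // Qy Ey /=.
    by have -> : (fun i => X i t) = y by apply/funext => i; exact: Ey.
  apply: countable_bigcupT_measurable => [|y]; first exact: countableP.
  by case: ifP.
pose V := U (fun y => Q (fun i => y i : nat)).
pose N := ~` U xpredT.
have mN : measurable N by apply: measurableC.
have PN : P N = 0%E.
  rewrite probability_setC // PU.
  have := draw_mean_expand xpredT; rewrite draw_mean_cst // => <-.
  by rewrite subee.
apply: (@le_trans _ _ (P (V `|` N))).
  apply: le_measure; [exact: mem_set|exact/mem_set/measurableU/mN/mU|].
  move=> t /= Qt; have [[y _ Ey]|] := pselect (U xpredT t); last by right.
  left; exists y => //=; rewrite mem_filter mem_enum andbT.
  by have <- : (fun i => X i t) = (fun i => y i : nat) by apply/funext.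
apply: (@le_trans _ _ (P V + P N)%E).
  by apply: measureU2 => //; exact: mU.
by rewrite PN adde0 PU draw_mean_expand.
Qed.
End Transfer.

(** * Riemann sums along a regular grid *)

Section Riemann.
Variable R : realType.
Implicit Types (f W : R -> R) (a b : R) (s : seq R) (xi : nat -> R).

(** All that is used of the relation between a density f and its primitive W.
    It is stable under reflection and negation, and spares any further appeal
    to the Lebesgue integral. *)
Definition brackets W f : Prop := forall c d m : R, c <= d ->
  ((forall x, c <= x <= d -> m <= f x) -> m * (d - c) <= W d - W c) /\
  ((forall x, c <= x <= d -> f x <= m) -> W d - W c <= m * (d - c)).

Lemma bracketsN W f : brackets W f -> brackets (fun x => - W x) (fun x => - f x).
Proof.
move=> Wf c d m cd; have [lo hi] := Wf c d (- m) cd.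
split=> fm.
  have : W d - W c <= - m * (d - c) by apply: hi => x /fm; rewrite lerNr.
  lra.
have : - m * (d - c) <= W d - W c by apply: lo => x /fm; rewrite lerNl.
lra.
Qed.

Lemma riemann_sum_cons f a b x s xi :
  riemann_sum f a b (x :: s) xi =
  f (xi 0%N) * (x - a) + riemann_sum f x b s (fun i => xi i.+1).
Proof. by rewrite /riemann_sum big_ord_recl. Qed.

Lemma riemann_sumN f a b s xi :
  riemann_sum (fun x => - f x) a b s xi = - riemann_sum f a b s xi.
Proof. by rewrite /riemann_sum -sumrN; apply: eq_bigr => i _; rewrite mulNr. Qed.

Definition tagged_in a b s xi := forall i, (i < size s)%N ->
  nth b (a :: s) i <= xi i <= nth b s i.

(** On each cell some value of f is at most the mean slope of W plus e:
    otherwise f would exceed that slope by e on the whole cell, and the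
    increment of W would be too large. *)
Lemma exists_low_riemann_sum W f a b s e : brackets W f -> 0 < e ->
  itv_partition a b s ->
  exists2 xi, tagged_in a b s xi &
    riemann_sum f a b s xi <= W b - W a + e * (b - a).
Proof.
move=> Wf e0; elim: s a => [|x s IHs] a.
  move=> /itv_partition_nil ->; exists (fun=> 0) => //.
  by rewrite /riemann_sum big_ord0 !subrr mulr0 addr0.
move=> abs; have /itv_partition_cons/IHs[xi xiP sxi] := abs.
have ax : a < x by case: abs => /= /andP[].
have [y /andP[ay yx] fy] : exists2 y, a <= y <= x &
    f y * (x - a) <= W x - W a + e * (x - a).
  apply: contrapT => nofy.
  pose q := (W x - W a) / (x - a).
  have qE : q * (x - a) = W x - W a by rewrite divfK // gt_eqF // subr_gt0.
  have [lo _] := Wf a x (q + e) (ltW ax).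
  have : W x - W a + e * (x - a) <= W x - W a.
    rewrite -{1}qE -mulrDl; apply: lo => y yax.
    rewrite -(ler_pM2r (_ : 0 < x - a)) ?subr_gt0 // mulrDl qE leNgt.
    by apply/negP => fy; apply: nofy; exists y => //; exact: ltW.
  by apply/negP; rewrite -ltNge ltrDl mulr_gt0 // subr_gt0.
exists (fun i => if i is j.+1 then xi j else y).
  by case=> [|i] /=; [rewrite ay yx|exact: xiP].
by rewrite riemann_sum_cons /=; lra.
Qed.

(** A fine Riemann sum is close to the Riemann integral; tags chosen low and
    tags chosen high then locate that integral on both sides of
    [W b - W a]. *)
Lemma riemann_sum_near W f a b : brackets W f -> a <= b ->
  riemann_integrable f a b -> forall e, 0 < e -> exists2 delta, 0 < delta &
  forall s xi, itv_partition a b s -> tagged_in a b s xi ->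
    (forall i, (i < size s)%N -> nth b s i - nth b (a :: s) i < delta) ->
  `|riemann_sum f a b s xi - (W b - W a)| <= e.
Proof.
move=> Wf ab [I If] e e0; have [|delta d0 H] := If (e / 4); first by lra.
exists delta => // s xi abs xis mesh.
(* The summand 1 only avoids dividing by b - a, which may be 0. *)
pose e' := e / 4 / (b - a + 1).
have e'0 : 0 < e' by rewrite divr_gt0 //; lra.
have e'E : e' * (b - a) <= e / 4.
  rewrite /e' -mulrA ler_piMr //; first by lra.
  by rewrite mulrC ler_pdivrMr; lra.
have [xi1 xi1s lo] := exists_low_riemann_sum Wf e'0 abs.
have [xi2 xi2s hi] := exists_low_riemann_sum (bracketsN Wf) e'0 abs.
rewrite riemann_sumN in hi.
have {}H x : tagged_in a b s x -> `|riemann_sum f a b s x - I| < e / 4.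
  by move=> xs; apply: H => // i si; split; [exact: mesh|exact: xs].
have := H _ xis; have := H _ xi1s; have := H _ xi2s.
rewrite !ltr_norml ler_norml => /andP[? ?] /andP[? ?] /andP[? ?].
by apply/andP; split; lra.
Qed.

Lemma itv_partition_cell a b s x : itv_partition a b s -> a < b ->
  a <= x <= b ->
  exists2 i, (i < size s)%N & nth b (a :: s) i <= x <= nth b s i.
Proof.
elim: s a => [|y s IHs] a; first by move/itv_partition_nil => ->; rewrite ltxx.
move=> abs ab /andP[ax xb]; have [xy|yx] := leP x y.
  by exists 0%N => //=; rewrite ax xy.
have /itv_partition_cons ybs := abs.
have [||i si xi] := IHs y ybs; [exact: lt_le_trans xb| |by exists i.+1].
by rewrite (ltW yx).
Qed.

Lemma itv_partition_lt a b s i : itv_partition a b s -> (i < size s)%N ->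
  nth b (a :: s) i < nth b s i.
Proof.
elim: s a i => // y s IHs a [|i] abs /=; first by case: abs => /= /andP[].
by rewrite ltnS; apply: IHs; exact: itv_partition_cons abs.
Qed.

(** The last cell, which ends at b, may be shorter than the step. *)
Lemma grid_partition a b h N : 0 < h -> a + N%:R * h < b ->
  let s := rcons [seq a + i.+1%:R * h | i <- iota 0 N] b in
  [/\ itv_partition a b s, size s = N.+1,
    forall i, (i <= N)%N -> nth b (a :: s) i = a + i%:R * h &
    forall i, nth b s i = if (i < N)%N then a + i.+1%:R * h else b].
Proof.
move=> h0 Nb s.
have sN : size s = N.+1 by rewrite size_rcons size_map size_iota.
have nths i : nth b s i = if (i < N)%N then a + i.+1%:R * h else b.
  rewrite nth_rcons size_map size_iota; case: ltnP => iN; last by case: ifP.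
  by rewrite (nth_map 0%N) ?size_iota // nth_iota.
have nthas i : (i <= N)%N -> nth b (a :: s) i = a + i%:R * h.
  by case: i => [|i] iN /=; [rewrite mul0r addr0|rewrite nths iN].
split=> //; split; last by rewrite last_rcons.
apply/(pathP b) => i; rewrite sN ltnS => iN.
rewrite nthas // nths; case: ifPn => [_|].
  by rewrite ltrD2l ltr_pM2r // ltr_nat.
by rewrite -leqNgt => Ni; have -> : i = N by apply/eqP; rewrite eqn_leq iN.
Qed.

Lemma exists_step (x h : R) : 0 < x -> 0 < h ->
  exists2 N : nat, N%:R * h < x & x <= N.+1%:R * h.
Proof.
move=> x0 h0.
have [n] : exists n : nat, x <= n%:R * h.
  exists (Num.truncn (x / h)).+1; rewrite -ler_pdivrMr //; apply/ltW.
  by rewrite truncnS_gt.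
elim: n => [|n IHn]; first by rewrite mul0r leNgt x0.
by have [/IHn//|nx] := leP x (n%:R * h); exists n.
Qed.

(** Fix a partition fine enough for Riemann sums to be within 1 of the
    integral.  Moving one tag changes the sum by at most 2, which bounds f on
    the cell of that tag. *)
Lemma riemann_integrable_bounded f a b : a < b -> riemann_integrable f a b ->
  exists C, forall x, a <= x <= b -> `|f x| <= C.
Proof.
move=> ab [I] /(_ 1 ltr01)[delta d0 H].
have [N Nb bN] := @exists_step (b - a) (delta / 2) ltac:(lra) ltac:(lra).
have h0 : 0 < delta / 2 by lra.
have [|] := @grid_partition a b (delta / 2) N h0; first by lra.
set s := rcons _ _ => abs sN nthas nths.
pose u i := nth b (a :: s) i; pose D i := nth b s i - u i.
have D0 i : (i < size s)%N -> 0 < D i.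
  by move=> si; rewrite /D subr_gt0; exact: itv_partition_lt.
have mesh i : (i < size s)%N -> D i < delta.
  rewrite sN ltnS => iN; rewrite /D /u nthas // nths -natr1.
  case: ifPn => iN'; first by lra.
  have -> : i = N by apply/eqP; rewrite eqn_leq iN leqNgt.
  by rewrite -natr1 in bN; lra.
(* A sum over all cells is a crude substitute for their maximum. *)
exists (\sum_(i < size s) (`|f (u i)| + 2 / D i)) => x xab.
have [i si /andP[ux xv]] := itv_partition_cell abs ab xab.
pose xi j := if j == i then x else u j.
have uT j : (j < size s)%N -> u j <= u j <= nth b s j.
  by move=> sj; rewrite lexx /= -subr_ge0 ltW // D0.
have H1 := H s u abs (fun j sj => conj (mesh j sj) (uT j sj)).
have H2 : `|riemann_sum f a b s xi - I| < 1.
  apply: H => // j sj; split; first exact: mesh.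
  by rewrite /xi; case: eqP => [->|_]; [rewrite ux xv|exact: uT].
have dE : riemann_sum f a b s xi - riemann_sum f a b s u = (f x - f (u i)) * D i.
  rewrite /riemann_sum -sumrB (bigD1 (Ordinal si)) //= big1 ?addr0.
    by rewrite /xi eqxx -mulrBl.
  by move=> j; rewrite -val_eqE /xi /= => /negPf ->; rewrite subrr.
have Di := D0 i si.
have fx : `|f x| <= `|f (u i)| + 2 / D i.
  have : `|(f x - f (u i)) * D i| <= 2.
    by rewrite -dE; move: H1 H2; rewrite !ltr_norml ler_norml; lra.
  rewrite normrM (gtr0_norm Di) -ler_pdivlMr // => le2.
  by rewrite -lerBlDl; apply: le_trans le2; exact: lerB_dist.
apply: le_trans fx _; rewrite (bigD1 (Ordinal si)) //= lerDl.
apply: sumr_ge0 => j _; rewrite addr_ge0 // divr_ge0 // ltW // D0 //.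
Qed.

(** The grid sum differs from a tagged Riemann sum on [0, A] only in the last
    cell, where the step replaces the true length; boundedness of f makes this
    error of the order of the step. *)
Lemma grid_sum_near W f A : 0 < A -> (forall x, 0 <= f x) -> brackets W f ->
  riemann_integrable f 0 A -> forall e, 0 < e -> exists2 h0, 0 < h0 &
  forall h N, 0 < h < h0 -> N%:R * h < A -> A <= N.+1%:R * h ->
  `|\sum_(m < N.+1) f (m%:R * h) * h - (W A - W 0)| <= e.
Proof.
move=> A0 f0 Wf If e e0.
have [C fC] := riemann_integrable_bounded A0 If.
have C0 : 0 <= C by apply: le_trans (normr_ge0 _) (fC 0 _); rewrite lexx ltW.
have [|d d0 H] := riemann_sum_near Wf (ltW A0) If (e := e / 2); first by lra.
exists (Num.min d (e / 2 / (C + 1))).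
  by rewrite lt_min d0 divr_gt0 //; lra.
move=> h N /andP[h0]; rewrite lt_min => /andP[hd hC] NA AN.
have [|] := @grid_partition 0 A h N h0; first by rewrite add0r.
set s := rcons _ _ => abs sN nthas nths.
have step i : (i <= N)%N -> 0 < nth A s i - nth A (0 :: s) i <= h.
  move=> iN; rewrite subr_gt0 itv_partition_lt ?sN //= nthas // nths -natr1.
  case: ifPn => iN'; first by lra.
  have -> : i = N by apply/eqP; rewrite eqn_leq iN leqNgt.
  by rewrite -natr1 in AN; lra.
pose xi i := nth A (0 :: s) i.
have /H-/(_ abs) : tagged_in 0 A s xi.
  move=> i; rewrite sN ltnS => iN; rewrite /xi lexx /=.
  by have /andP[+ _] := step i iN; rewrite subr_gt0 => /ltW.
move=> {}H.
have {}H : `|riemann_sum f 0 A s xi - (W A - W 0)| <= e / 2.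
  apply: H => i; rewrite sN ltnS => /step /andP[_ ih]; exact: le_lt_trans hd.
have hC2 : (C + 1) * h <= e / 2.
  by rewrite mulrC -ler_pdivlMr ?ltW //; lra.
have rE : riemann_sum f 0 A s xi =
    \sum_(m < N.+1) f (m%:R * h) * h - f (N%:R * h) * (N.+1%:R * h - A).
  rewrite /riemann_sum sN !big_ord_recr /= /xi nthas // nths ltnn add0r.
  rewrite -addrA; congr (_ + _).
    apply: eq_bigr => i _; rewrite nthas ?add0r; last by rewrite ltnW.
    by rewrite nths ltn_ord add0r -natr1; congr (_ * _); lra.
  by rewrite -natr1; lra.
have fN : f (N%:R * h) <= C.
  apply: le_trans (ler_norm _) (fC _ _).
  by rewrite (ltW NA) andbT mulr_ge0 // ltW.
have := f0 (N%:R * h).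
move: H; rewrite !ler_norml rE.
set S := \sum_(m < _) _; set v := f _ in fN * => /andP[H1 H2] v0.
have t0 : 0 <= N.+1%:R * h - A by lra.
have t1 : N.+1%:R * h - A <= h by rewrite -natr1; lra.
have p0 : 0 <= v * (N.+1%:R * h - A) by rewrite mulr_ge0.
have p1 : v * (N.+1%:R * h - A) <= C * h by apply: ler_pM.
by apply/andP; split; lra.
Qed.

(** Up to A the sum is a Riemann sum.  Beyond A, where f is nonincreasing, a
    term [f(mh) h] is at most the increment of W over the cell that precedes
    [mh], and these increments telescope to a tail of W.  Hence the estimate
    holds uniformly in the number N of terms. *)
Lemma half_line_sum_near W f Winf K0 : (forall x, 0 <= f x) -> brackets W f ->
  (forall A, 0 <= A -> riemann_integrable f 0 A) ->
  (forall x y, K0 <= x -> x <= y -> f y <= f x) ->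
  (forall e, 0 < e -> exists A, forall x, A <= x -> `|W x - Winf| <= e) ->
  forall e, 0 < e -> exists A, exists2 h0, 0 < h0 &
  forall h N, 0 < h < h0 -> A <= N%:R * h ->
  `|\sum_(m < N) f (m%:R * h) * h - (Winf - W 0)| <= e.
Proof.
move=> f0 Wf If fK Wlim e e0.
have [|A1 WA1] := Wlim (e / 4); first by lra.
(* The margin 1 exceeds the step, so the cell before the first tail term
   already lies beyond K0 and A1. *)
pose A := `|K0| + `|A1| + 1.
have K0A : K0 <= A - 1 by have := ler_norm K0; have := normr_ge0 A1; rewrite /A; lra.
have A1A : A1 <= A - 1 by have := ler_norm A1; have := normr_ge0 K0; rewrite /A; lra.
have A0 : 0 < A by rewrite /A; have := normr_ge0 A1; have := normr_ge0 K0; lra.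
have [|h0 h00 H] := grid_sum_near A0 f0 Wf (If A (ltW A0)) (e := e / 4).
  by lra.
exists A, (Num.min h0 1); first by rewrite lt_min h00 ltr01.
move=> h N /andP[hgt0]; rewrite lt_min => /andP[hh0 h1] AN.
have [n nA An] := exists_step A0 hgt0.
have {H} := H h n ltac:(by rewrite hgt0 hh0) nA An.
have nN : (n < N)%N.
  by rewrite -(ltr_nat R) -(ltr_pM2r hgt0); exact: lt_le_trans AN.
have -> : N = (n.+1 + (N - n.+1))%N by rewrite subnKC.
move: (N - n.+1)%N => j {N AN nN}.
have nA' : A - 1 <= n%:R * h by rewrite -natr1 in An; lra.
have nj i : A - 1 <= (n + i)%:R * h.
  by apply: le_trans nA' _; rewrite ler_pM2r // ler_nat leq_addr.
have lo : \sum_(m < n.+1) f (m%:R * h) * h <=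
    \sum_(m < n.+1 + j) f (m%:R * h) * h.
  rewrite big_split_ord /= lerDl; apply: sumr_ge0 => i _.
  by rewrite mulr_ge0 // ltW.
have hi : \sum_(m < n.+1 + j) f (m%:R * h) * h <=
    \sum_(m < n.+1) f (m%:R * h) * h + (W ((n + j)%:R * h) - W (n%:R * h)).
  elim: j {lo} => [|j IHj]; first by rewrite !addn0; lra.
  rewrite addnS big_ord_recr /=.
  have [+ _] := Wf ((n + j)%:R * h) ((n + j).+1%:R * h) (f ((n + j).+1%:R * h))
    ltac:(by rewrite ler_pM2r // ler_nat).
  move=> /(_ _)/wrap[x /andP[x1 x2]|]; first apply: fK => //.
    by apply: le_trans x1; apply: le_trans (nj j).
  have -> : (n + j).+1%:R * h - (n + j)%:R * h = h by rewrite -natr1; lra.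
  rewrite addSn addnS; lra.
have := WA1 A; have := WA1 (n%:R * h); have := WA1 ((n + j)%:R * h).
move=> /(_ (le_trans A1A (nj j))) W1 /(_ (le_trans A1A nA')) W2 /(_ _)/wrap[|W3]; first by lra.
move: W1 W2 W3; rewrite !ler_norml => /andP[? ?] /andP[? ?] /andP[? ?] /andP[? ?].
by apply/andP; split; lra.
Qed.
End Riemann.

(** * The distribution function of a density *)

Section Density.
Variables (R : realType) (w : R -> R).
Hypothesis w_density : is_density setT w.
Notation mu := (@lebesgue_measure R).

Let w0 x : 0 <= w x. Proof. by case: w_density => _ + _; apply. Qed.

Let mw (A : set R) : measurable_fun A (EFin \o w).
Proof.
by apply: measurable_funTS; apply/measurable_EFinP; case: w_density.
Qed.

Definition density_mass (A : set R) : R :=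
  fine (\int[mu]_(x in A) (w x)%:E)%E.

Lemma density_massE A : measurable A ->
  (\int[mu]_(x in A) (w x)%:E = (density_mass A)%:E)%E.
Proof.
move=> mA; rewrite /density_mass fineK //.
rewrite ge0_fin_numE; last by apply: integral_ge0 => x _; rewrite lee_fin.
apply: (@le_lt_trans _ _ 1%E); last exact: ltry.
have [_ _ <-] := w_density.
apply: ge0_subset_integral => //; first exact: mw.
by move=> x _; rewrite lee_fin.
Qed.

Lemma density_mass_ge0 A : 0 <= density_mass A.
Proof. by apply/fine_ge0/integral_ge0 => x _; rewrite lee_fin. Qed.

Lemma density_mass_le A B : measurable A -> measurable B -> A `<=` B ->
  density_mass A <= density_mass B.
Proof.
move=> mA mB AB; rewrite -lee_fin -!density_massE //.
apply: ge0_subset_integral => //; first exact: mw.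
by move=> x _; rewrite lee_fin.
Qed.

Lemma density_massT : density_mass setT = 1.
Proof. by rewrite /density_mass; have [_ _ ->] := w_density. Qed.

Definition density_cdf (x : R) := density_mass `]-oo, x].

Lemma density_cdf_itv c d : c <= d ->
  density_cdf d - density_cdf c = density_mass `]c, d].
Proof.
move=> cd; apply/eqP; rewrite subr_eq; apply/eqP/EFin_inj.
rewrite EFinD -!density_massE //.
have -> : `]-oo, d]%classic = `]c, d]%classic `|` `]-oo, c]%classic.
  by rewrite setUC -itv_bndbnd_setU ?bnd_simp.
rewrite ge0_integral_setU //; [exact: mw|by move=> x _; rewrite lee_fin|].
apply/disj_setPS => x /=; rewrite !in_itv /= => -[/andP[cx _] xc].
by have := lt_le_trans cx xc; rewrite ltxx.
Qed.

Lemma brackets_density_cdf : brackets density_cdf w.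
Proof.
move=> c d m cd; rewrite density_cdf_itv //.
have mI : mu `]c, d] = (d - c)%:E.
  rewrite lebesgue_measure_itv /= lte_fin; case: ltP => [_|dc]; first by rewrite EFinB.
  rewrite (_ : d = c) ?subrr //; lra.
have itvP x : `]c, d]%classic x -> c <= x <= d.
  by rewrite /= in_itv /= => /andP[/ltW -> ->].
split=> mle.
  have [m0|m0] := leP 0 m; last first.
    by apply: le_trans (density_mass_ge0 _); rewrite nmulr_rle0 // subr_ge0.
  rewrite -lee_fin -density_massE // EFinM -mI.
  rewrite -(@integral_cst _ _ _ mu `]c, d]%classic _ m%:E) //.
  apply: ge0_le_integral => //= [|x /itvP xcd]; first exact: mw.
  by rewrite lee_fin; exact: mle.
have m0 : 0 <= m by apply: le_trans (w0 c) (mle c _); rewrite lexx cd.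
rewrite -lee_fin -density_massE // EFinM -mI.
rewrite -(@integral_cst _ _ _ mu `]c, d]%classic _ m%:E) //.
apply: ge0_le_integral => //= [x _||x /itvP xcd]; rewrite ?lee_fin //.
  exact: mw.
exact: mle.
Qed.

Lemma density_cdf_le1 x : 0 <= density_cdf x <= 1.
Proof.
by rewrite density_mass_ge0 /= -density_massT; exact: density_mass_le.
Qed.

(** The mass of [(-n, n]] tends to 1, and bounds both tails at once. *)
Lemma density_cdf_lim (e : R) : 0 < e -> exists A, forall x, A <= x ->
  `|density_cdf x - 1| <= e /\ `|density_cdf (- x)| <= e.
Proof.
move=> e0; pose F (n : nat) := `](- n%:R : R), (n%:R : R)]%classic.
have F_itv n x : F n x = (- n%:R < x <= n%:R) :> Prop by rewrite /F /= in_itv.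
have : (\int[mu]_(x in F i) (w x)%:E @[i --> \oo] -->
         \int[mu]_(x in \bigcup_i F i) (w x)%:E)%E.
  apply: ge0_nondecreasing_set_cvg_integral => //.
  - move=> m n mn; apply/subsetPset => x; rewrite !F_itv => /andP[mx xm].
    have : m%:R <= n%:R :> R by rewrite ler_nat.
    by move=> ?; apply/andP; split; lra.
  - by move=> i; exact: measurable_itv.
  - by move=> i; exact: mw.
  - by move=> i x _; rewrite lee_fin.
have -> : \bigcup_i F i = setT.
  rewrite -subTset => x _; exists (Num.truncn `|x|).+1 => //.
  have := truncnS_gt `|x|; rewrite F_itv ltr_norml => /andP[-> /ltW //].
rewrite (density_massE measurableT) density_massT.
have mF i : measurable (F i) by exact: measurable_itv.
under eq_fun do rewrite (density_massE (mF _)).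
move=> /fine_cvgP[_ /cvgrPdist_le/(_ e e0)[n _ /(_ n (leqnn n))/= H]].
have mono x y : x <= y -> density_cdf x <= density_cdf y.
  by move=> xy; rewrite -subr_ge0 density_cdf_itv // density_mass_ge0.
have n0 : 0 <= n%:R :> R by [].
move: H; rewrite -density_cdf_itv; last lra.
have /andP[Wn0 Wn1] := density_cdf_le1 n%:R.
have /andP[Wm0 Wm1] := density_cdf_le1 (- n%:R).
rewrite ler_norml => /andP[_ H].
exists n%:R => x nx.
have /andP[Wx0 Wx1] := density_cdf_le1 x.
have /andP[Wy0 Wy1] := density_cdf_le1 (- x).
have := mono _ _ nx; have := mono (- x) (- n%:R); rewrite lerN2 => /(_ nx).
by rewrite !ler_norml => ? ?; split; apply/andP; split; lra.
Qed.
End Density.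

(** * Reflection, and monotone tails *)

Section Kernel.
Variable R : realType.

(** Reversing a tagged partition of [-b, -a] gives one of [a, b] with the same
    Riemann sum for the reflected function. *)
Lemma riemann_integrable_opp (f : R -> R) a b :
  riemann_integrable f a b -> riemann_integrable (f \o -%R) (- b) (- a).
Proof.
case=> I H; exists I => e e0; have [d d0 {}H] := H e e0.
exists d => // s xi abs xis.
pose t := - b :: s; pose n := size s.
pose s' := rev (map -%R (belast (- b) s)).
have lastE : last (- b) s = - a by case: abs => _ /eqP.
have asE : a :: s' = rev (map -%R t).
  by rewrite /t (lastI (- b) s) lastE map_rcons rev_rcons opprK.
have ss' : size s' = n by rewrite size_rev size_map size_belast.
have nth0 i : (i <= n)%N -> nth b (a :: s') i = - nth (- a) t (n - i).
  have st : size t = n.+1 by [].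
  move=> iN; rewrite asE nth_rev size_map st ?subSS //.
  by rewrite (nth_map (- a)) // st ltnS leq_subr.
have nth1 i : (i < n)%N -> nth b s' i = - nth (- a) t (n - i.+1).
  by move=> iN; rewrite -nth0.
have rn i : (i < n)%N -> (n - i = (n - i.+1).+1)%N by move=> iN; rewrite subnSK.
have rlt i : (i < n)%N -> (n - i.+1 < n)%N by move=> iN; rewrite -rn // leq_subr.
have tS i : nth (- a) t i.+1 = nth (- a) s i by [].
have abs' : itv_partition a b s'.
  split.
    apply/(pathP b) => i; rewrite ss' => iN; rewrite nth0 ?nth1 //; last exact: ltnW.
    by rewrite ltrN2 (rn i) // tS; exact: itv_partition_lt abs (rlt i iN).
  have [n0|n0] := posnP n.
    have := nth0 0%N (leq0n _); rewrite (size0nil n0) in abs *.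
    have s'0 : s' = [::] by apply: size0nil; rewrite ss'.
    by rewrite s'0 /= -n0; have := itv_partition_nil abs; lra.
  by rewrite -nth_last ss' (set_nth_default b) ?ss' ?prednK // nth1 ?prednK // subnn /t /= opprK.
have -> : riemann_sum (f \o -%R) (- b) (- a) s xi =
    riemann_sum f a b s' (fun i => - xi (n - i.+1)%N).
  rewrite /riemann_sum ss' (reindex_inj rev_ord_inj) /=; apply: eq_bigr => i _.
  rewrite nth1 ?nth0 // 1?ltnW // (rn i) // tS.
  by congr (_ * _); rewrite opprK addrC.
apply: H => // i; rewrite ss' => iN.
have [d1 /andP[d2 d3]] := xis _ (rlt i iN).
rewrite nth1 // nth0 1?ltnW // (rn i) // tS !lerN2 d3 /=.
by rewrite -/t d2; split => //; rewrite opprK addrC.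
Qed.

Lemma brackets_opp (W f : R -> R) :
  brackets W f -> brackets (fun x => - W (- x)) (f \o -%R).
Proof.
move=> Wf c d m cd; have [|lo hi] := Wf (- d) (- c) m; first by rewrite lerN2.
have -> : d - c = - c - - d by rewrite opprK addrC.
have -> : - W (- d) - - W (- c) = W (- c) - W (- d) by rewrite opprK addrC.
split=> fm.
  by apply: lo => x; have := fm (- x); rewrite /= opprK lerNl lerNr andbC.
by apply: hi => x; have := fm (- x); rewrite /= opprK lerNl lerNr andbC.
Qed.

(** A positive value persists to the right of its argument, and would make W
    increase without bound. *)
Lemma nondecreasing_tail_le0 (W f : R -> R) K0 : brackets W f ->
  (forall x, `|W x| <= 1) ->
  (forall x y, K0 <= x -> x <= y -> f x <= f y) ->
  forall x, K0 <= x -> f x <= 0.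
Proof.
move=> Wf W1 fK x Kx; rewrite leNgt; apply/negP => fx0.
have L0 : 0 < 3 / f x by rewrite divr_gt0.
have [|+ _] := Wf x (x + 3 / f x) (f x); first by rewrite lerDl ltW.
move=> /(_ _)/wrap[y /andP[xy _]|]; first exact: fK.
rewrite addrC addKr mulrC divfK ?gt_eqF //.
have := W1 x; have := W1 (x + 3 / f x); rewrite !ler_norml.
by move=> /andP[? ?] /andP[? ?]; lra.
Qed.
End Kernel.

(** * Sums of kernel weights *)

Section KernelSums.
Variables (R : realType) (w : R -> R).
Hypothesis w_density : is_density setT w.
Hypothesis w_integrable : forall a b : R, a <= b -> riemann_integrable w a b.
Hypothesis w_tails : bounded_support w \/ ultimately_monotone w.

Let w0 x : 0 <= w x. Proof. by case: w_density => _ + _; apply. Qed.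

(** In its tails w decreases away from the origin: a bounded support makes it
    vanish there, and so does a tail that is monotone in the other direction,
    by integrability. *)
Lemma density_tails_nonincreasing : exists K0, forall x y, K0 <= x -> x <= y ->
  w y <= w x /\ w (- y) <= w (- x).
Proof.
case: w_tails => [[K wK]|[K K0 [wl wr]]].
  exists (K + 1) => x y Kx xy; have yy := ler_norm y; have xx := ler_norm x.
  by rewrite !wK ?normrN //; lra.
have Wf := brackets_density_cdf w_density.
have W01 := density_cdf_le1 w_density.
exists K => x y Kx xy; have Ky := le_trans Kx xy; split.
  case: wr => [up|]; last first.
    by apply=> //; rewrite /= in_itv /= ?andbT.
  apply: (@le_trans _ _ 0); last exact: w0.
  apply: (@nondecreasing_tail_le0 R (density_cdf w) w K) => //.
    by move=> z; have /andP[? ?] := W01 z; rewrite ger0_norm.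
  by move=> u v Ku uv; apply: up; rewrite //= in_itv /= andbT // (le_trans Ku).
case: wl => [up|down].
  by apply: up; rewrite ?lerN2 //= in_itv /= lerN2.
apply: (@le_trans _ _ 0); last exact: w0.
apply: (@nondecreasing_tail_le0 R _ (w \o -%R) K (brackets_opp Wf)) => //.
  by move=> z; have /andP[? ?] := W01 (- z); rewrite normrN ger0_norm.
move=> u v Ku uv; apply: down; rewrite ?lerN2 //= in_itv /= lerN2 //.
exact: le_trans uv.
Qed.

Lemma right_sum_near e : 0 < e -> exists A, exists2 h0, 0 < h0 &
  forall h N, 0 < h < h0 -> A <= N%:R * h ->
  `|\sum_(m < N) w (m%:R * h) * h - (1 - density_cdf w 0)| <= e.
Proof.
have [K0 wK] := density_tails_nonincreasing.
apply: (@half_line_sum_near R (density_cdf w) w 1 K0) => //.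
- exact: brackets_density_cdf.
- by move=> A A0; exact: w_integrable.
- by move=> x y Kx xy; have [] := wK x y Kx xy.
- move=> d d0; have [A HA] := density_cdf_lim w_density d0.
  by exists A => x Ax; have [] := HA x Ax.
Qed.

Lemma left_sum_near e : 0 < e -> exists A, exists2 h0, 0 < h0 &
  forall h N, 0 < h < h0 -> A <= N%:R * h ->
  `|\sum_(m < N) w (- (m%:R * h)) * h - density_cdf w 0| <= e.
Proof.
have [K0 wK] := density_tails_nonincreasing.
have := @half_line_sum_near R (fun x => - density_cdf w (- x)) (w \o -%R) 0 K0.
rewrite oppr0 opprK add0r; apply=> //.
- by move=> x; exact: w0.
- exact/brackets_opp/brackets_density_cdf.
- move=> A A0; rewrite -[0]oppr0 -[A]opprK.
  by apply: riemann_integrable_opp; apply: w_integrable; rewrite oppr_le0.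
- by move=> x y Kx xy; have [] := wK x y Kx xy.
- move=> d d0; have [A HA] := density_cdf_lim w_density d0.
  by exists A => x Ax; rewrite addr0 normrN; have [] := HA x Ax.
Qed.

(** Both half-line sums contain the term of index i = j. *)
Lemma kernel_sum_split (h : R) lo j hi : (lo <= j < hi)%N ->
  \sum_(lo <= i < hi) w ((j%:R - i%:R) * h) * h =
  \sum_(m < j.+1 - lo) w (m%:R * h) * h
  + \sum_(m < hi - j) w (- (m%:R * h)) * h - w 0 * h.
Proof.
move=> /andP[loj jhi].
rewrite (@big_cat_nat _ _ _ j.+1) //=; last exact: leqW.
have -> : \sum_(m < hi - j) w (- (m%:R * h)) * h =
    w 0 * h + \sum_(j.+1 <= i < hi) w ((j%:R - i%:R) * h) * h.
  rewrite -(big_mkord xpredT (fun m => w (- (m%:R * h)) * h)).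
  rewrite big_ltn ?subn_gt0 // mul0r oppr0; congr (_ + _).
  have -> F : \sum_(j.+1 <= i < hi) F i = \sum_(1 <= i < hi - j) F (i + j)%N :> R.
    by rewrite -add1n big_addn.
  apply: eq_bigr => i _; congr (w _ * _).
  by rewrite natrD -mulNr; congr (_ * _); lra.
have -> : \sum_(m < j.+1 - lo) w (m%:R * h) * h =
    \sum_(lo <= i < j.+1) w ((j%:R - i%:R) * h) * h.
  rewrite -(big_mkord xpredT (fun m => w (m%:R * h) * h)).
  have -> F : \sum_(lo <= i < j.+1) F i =
      \sum_(0 <= i < j.+1 - lo) F (i + lo)%N :> R.
    by rewrite -{1}[lo]add0n big_addn.
  rewrite big_nat_rev !big_nat.
  apply: eq_bigr => i /andP[_ ij]; congr (w (_ * _) * _).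
  have {}ij : (i <= j - lo)%N by rewrite -ltnS -subSn.
  rewrite add0n subSn // subSS natrB // natrB //.
  by rewrite natrD opprD addrA addrAC.
lra.
Qed.

(** Any window that extends by at least A/h cells on both sides of j already
    carries almost all the weight.  Comparing two windows shows that the weight
    outside the smaller one is negligible. *)
Lemma kernel_sum_near e : 0 < e -> exists2 A, 0 < A & exists2 h0, 0 < h0 &
  forall h lo j hi, 0 < h < h0 -> (lo <= j < hi)%N ->
  A <= (j.+1 - lo)%:R * h -> A <= (hi - j)%:R * h ->
  `|\sum_(lo <= i < hi) w ((j%:R - i%:R) * h) * h - 1| <= e.
Proof.
move=> e0; have e3 : 0 < e / 3 by rewrite divr_gt0.
have [A1 [h1 h10 H1]] := right_sum_near e3.
have [A2 [h2 h20 H2]] := left_sum_near e3.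
exists (`|A1| + `|A2| + 1).
  by rewrite ltr_wpDl // addr_ge0.
have wp : 0 < w 0 + 1 by rewrite ltr_wpDl.
exists (Num.min (Num.min h1 h2) (e / 3 / (w 0 + 1))).
  by rewrite !lt_min h10 h20 divr_gt0.
move=> h lo j hi /andP[h0]; rewrite !lt_min => /andP[/andP[hh1 hh2] hw] jin.
move=> AN1 AN2; rewrite kernel_sum_split //.
have [n1 n2] : A1 <= `|A1| /\ A2 <= `|A2| by rewrite !ler_norm.
have [p1 p2] : 0 <= `|A1| /\ 0 <= `|A2| by [].
have := H1 h (j.+1 - lo)%N; rewrite h0 hh1 => /(_ isT)/(_ ltac:(lra)).
have := H2 h (hi - j)%N; rewrite h0 hh2 => /(_ isT)/(_ ltac:(lra)).
have : 0 <= w 0 * h by rewrite mulr_ge0 // ltW.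
have : w 0 * h <= e / 3.
  by move: hw; rewrite ltr_pdivlMr // => /ltW; rewrite mulrDr mulr1 mulrC; lra.
rewrite !ler_norml => ? ? /andP[? ?] /andP[? ?].
by apply/andP; split; lra.
Qed.

(** The half-line estimates hold only for long sums, but the terms are
    nonnegative: lengthen the sums first. *)
Lemma kernel_sum_bounded : exists2 h0, 0 < h0 &
  forall h lo j hi, 0 < h < h0 -> (lo <= j < hi)%N ->
  \sum_(lo <= i < hi) w ((j%:R - i%:R) * h) * h <= 4.
Proof.
have [A1 [h1 h10 H1]] := right_sum_near (ltr01 : 0 < 1 :> R).
have [A2 [h2 h20 H2]] := left_sum_near (ltr01 : 0 < 1 :> R).
exists (Num.min h1 h2) => [|h lo j hi /andP[h0]]; first by rewrite lt_min h10.
rewrite lt_min => /andP[hh1 hh2] jin; rewrite kernel_sum_split //.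
have long A : exists n : nat, A <= n%:R * h.
  exists (Num.truncn (A / h)).+1; rewrite -ler_pdivrMr //; apply/ltW.
  by rewrite truncnS_gt.
have mono (f : nat -> R) n m : (forall i, 0 <= f i) ->
    \sum_(i < n) f i * h <= \sum_(i < n + m) f i * h.
  move=> f0; rewrite big_split_ord /= lerDl; apply: sumr_ge0 => i _.
  by rewrite mulr_ge0 // ltW.
have [m1 Am1] := long A1; have [m2 Am2] := long A2.
have longer A m n : A <= m%:R * h -> A <= (n + m)%:R * h.
  by move=> /le_trans; apply; rewrite ler_pM2r // ler_nat leq_addl.
have := H1 h _ _ (longer _ _ (j.+1 - lo)%N Am1); rewrite h0 hh1 => /(_ isT).
have := H2 h _ _ (longer _ _ (hi - j)%N Am2); rewrite h0 hh2 => /(_ isT).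
have := mono (fun m => w (m%:R * h)) (j.+1 - lo)%N m1 (fun _ => w0 _).
have := mono (fun m => w (- (m%:R * h))) (hi - j)%N m2 (fun _ => w0 _).
have : 0 <= w 0 * h by rewrite mulr_ge0 // ltW.
have /andP[? ?] := density_cdf_le1 w_density 0.
rewrite !ler_norml => ? ? ? /andP[? ?] /andP[? ?]; lra.
Qed.

(** Riemann integrability bounds w on a compact interval, and the monotone
    tails extend the bound to the line. *)
Lemma density_bounded : exists2 C, 0 < C & forall x, w x <= C.
Proof.
have [K0 wK] := density_tails_nonincreasing.
have [K K1 K2] : exists2 K : R, K0 <= K & 0 < K.
  by exists (`|K0| + 1); have := ler_norm K0; have := normr_ge0 K0; lra.
have NKK : - K < K by lra.
have [C wC] := riemann_integrable_bounded NKK (w_integrable (ltW NKK)).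
exists (`|C| + 1) => [|x]; first by have := normr_ge0 C; lra.
suff : w x <= C by have := ler_norm C; lra.
have wC' y : - K <= y <= K -> w y <= C by move=> /wC; rewrite ger0_norm.
have [xK|Kx] := leP x K; last first.
  have [+ _] := wK K x K1 (ltW Kx); move=> /le_trans; apply.
  by apply: wC'; apply/andP; split; lra.
have [Kx|xK'] := leP (- K) x; first by apply: wC'; rewrite Kx.
have Kx : K <= - x by lra.
have [_] := wK K (- x) K1 Kx; rewrite opprK => /le_trans; apply.
by apply: wC'; apply/andP; split; lra.
Qed.
End KernelSums.

(** * Counting the cells where g is at most y *)

Section UnitInterval.
Variables (R : realType) (g : R -> R).
Hypothesis g_continuous : {within `[0, 1], continuous g}.

(** Heine-Cantor, from the covering form of the compactness of [0, 1]. *)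
Lemma unit_uniform_continuous (e : R) : 0 < e -> exists2 d, 0 < d &
  forall x y, 0 <= x <= 1 -> 0 <= y <= 1 -> `|x - y| <= d ->
    `|g x - g y| <= e.
Proof.
move=> e0.
pose Q (d x : R) := 0 <= x <= 1 -> forall y, 0 <= y <= 1 -> `|x - y| <= d ->
  `|g x - g y| <= e.
have /compact_near_coveringP/(_ _ (0^'+) Q) : compact `[0 : R, 1].
  exact: segment_compact.
move=> /(_ _ _)/wrap[x x01|].
  have /subspace_continuousP/(_ x x01)/cvgrPdist_lt/(_ (e / 2)) := g_continuous.
  rewrite divr_gt0 // => /(_ isT); rewrite /within /= => -[d /= d0 dP].
  have dP' y : 0 <= y <= 1 -> `|x - y| < d -> `|g x - g y| < e / 2.
    by move=> y01 xy; apply: dP => //=; rewrite in_itv.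
  near=> z t => z01 y y01 zy.
  have xz : `|x - z| < d / 2 by near: z; apply: nbhsx_ballx; lra.
  have td : t < d / 2 by near: t; apply: nbhs_right_lt; lra.
  have gz : `|g x - g z| < e / 2 by apply: dP' => //; lra.
  have gy : `|g x - g y| < e / 2.
    apply: dP' => //; apply: le_lt_trans (ler_distD z _ _) _.
    by rewrite [d]splitr ltrD // (le_lt_trans zy).
  apply: le_trans (ler_distD (g x) _ _) _.
  by rewrite [e]splitr lerD // ltW // distrC.
move=> Qd; near ((0:R)^'+) => d.
exists d; first by near: d; exact: nbhs_right_gt.
move=> x y x01 y01 xy.
have : `[0, 1]%classic `<=` Q d by near: d.
by move=> /(_ x); rewrite /= in_itv /= => /(_ x01); apply.
Unshelve. all: by end_near. Qed.

Hypothesis g_density : is_density `[0, 1] g.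

Lemma unit_density_bounded : exists2 G, 0 < G &
  forall x, 0 <= x <= 1 -> 0 <= g x <= G.
Proof.
have [c c01 gc] := EVT_max ler01 g_continuous.
have g0 x : 0 <= x <= 1 -> 0 <= g x.
  by move=> x01; case: g_density => _ + _; apply; rewrite /= in_itv.
exists (g c + 1) => [|x x01].
  by rewrite ltr_wpDl // g0 //; move: c01; rewrite in_itv.
rewrite g0 //=; apply: le_trans (gc x _) _; rewrite ?in_itv //.
by rewrite lerDl.
Qed.

Notation U01 := (uniform_prob (@ltr01 R)).

(** Subadditivity: each cell has probability at most 1/M. *)
Lemma uniform_prob_cells (M : nat) (S : pred nat) (A : set R) : measurable A ->
  (A `<=` \bigcup_(j in [set j | (j < M)%N && S j]) `]j%:R / M%:R, j.+1%:R / M%:R]%classic) ->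
  (U01 A <= (M%:R^-1 * \sum_(j < M) (S j)%:R)%:E)%E.
Proof.
move=> mA Asub.
pose E (j : nat) : set R :=
  if S j then `]j%:R / M%:R, j.+1%:R / M%:R]%classic else set0.
have mE j : measurable (E j) by rewrite /E; case: ifP.
have cell j : (U01 `](j%:R / M%:R)%R, (j.+1%:R / M%:R)%R]%classic <= (M%:R^-1)%:E)%E.
  rewrite /uniform_prob.
  apply: (@le_trans _ _
    (\int[@lebesgue_measure R]_(x in `](j%:R / M%:R)%R, (j.+1%:R / M%:R)%R]) (cst 1%E) x)%E).
    apply: ge0_le_integral => //= [x _||x _].
    - by rewrite lee_fin uniform_pdf_ge0.
    - by apply: measurable_funTS; apply: measurableT_comp => //; exact: measurable_uniform_pdf.
    - by rewrite lee_fin /uniform_pdf subr0 invr1; case: ifP.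
  have : (lebesgue_measure (`](j%:R / M%:R)%R, (j.+1%:R / M%:R)%R]%classic : set R)
      <= (M%:R^-1)%:E)%E.
    rewrite lebesgue_measure_itv /= lte_fin.
    case: ifP => _; last by rewrite lee_fin invr_ge0.
    by rewrite -EFinB lee_fin -mulrBl -natr1 addrAC subrr add0r mul1r.
  by rewrite integral_cst // mul1e.
have : (U01 A <= \sum_(j < M) U01 (E j))%E.
  apply: content_subadditive => [j _| //|x]; first exact: mE.
  move=> /Asub[j /= /andP[jM Sj] xj]; rewrite -bigcup_mkord.
  by exists j => //; rewrite /E Sj.
move=> /le_trans; apply.
rewrite mulr_sumr -sumEFin; apply: lee_sum => j _; rewrite /E; case: ifP => _.
  by rewrite mulr1.
by rewrite measure0 mulr0.
Qed.

Lemma uniform_prob_itv01 : U01 `]0, 1[ = 1%E.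
Proof.
rewrite /uniform_prob -(@integral_itv_bndoo _ _ _ _ true false).
  by rewrite integral_uniform_pdf1.
by apply: measurable_funTS; apply: measurableT_comp => //; exact: measurable_uniform_pdf.
Qed.

Let m_le (y : R) : measurable (`]0, 1[ `&` [set u | g u <= y]).
Proof.
have [mg _ _] := g_density.
have mg' : measurable_fun (`]0, 1[ : set R) g.
  apply: measurable_funS mg => // x /=; rewrite !in_itv /= => /andP[x0 x1].
  by rewrite !ltW.
have -> : [set u | g u <= y] = g @^-1` `]-oo, y].
  by apply/seteqP; split => u /=; rewrite in_itv.
exact: mg'.
Qed.

Let U01E (y : R) : U01 (`]0, 1[ `&` [set u | g u <= y]) = (uniform_image_df g y)%:E.
Proof.
by rewrite /uniform_image_df fineK //; apply: fin_num_measure; exact: m_le.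
Qed.

Lemma exists_cell (M : nat) (u : R) : (0 < M)%N -> 0 < u < 1 ->
  exists2 j : nat, (j < M)%N & j%:R / M%:R < u <= j.+1%:R / M%:R.
Proof.
move=> M0 /andP[u0 u1]; have MR : 0 < M%:R^-1 :> R by rewrite invr_gt0 ltr0n.
have [j ju uj] := exists_step u0 MR.
exists j; last by rewrite ju uj.
rewrite -(ltr_nat R) -(ltr_pM2r MR) (lt_trans ju) // divff //.
by rewrite pnatr_eq0 -lt0n.
Qed.

Section Count.
Variables (M : nat) (e : R).
Hypothesis M0 : (0 < M)%N.
Hypothesis ge : forall x y, 0 <= x <= 1 -> 0 <= y <= 1 ->
  `|x - y| <= M%:R^-1 -> `|g x - g y| <= e.

Let near_end (j : nat) (u : R) : (j < M)%N ->
  0 < u < 1 -> j%:R / M%:R < u <= j.+1%:R / M%:R ->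
  `|g u - g (j.+1%:R / M%:R)| <= e.
Proof.
move=> jM /andP[u0 u1] /andP[ju uj]; apply: ge.
- by rewrite !ltW.
- rewrite divr_ge0 //= ler_pdivrMr ?ltr0n // mul1r ler_nat //.
- rewrite ler_norml; rewrite -natr1 mulrDl mul1r in uj *.
  by apply/andP; split; [|have : 0 <= M%:R^-1 :> R by []]; lra.
Qed.

(** If [g u <= y - e], then g is at most y at the right end of the cell of
    u. *)
Lemma uniform_image_df_le_count y :
  uniform_image_df g (y - e) <=
  M%:R^-1 * \sum_(j < M) (g (j.+1%:R / M%:R) <= y)%R%:R.
Proof.
rewrite -lee_fin -U01E.
apply: (@uniform_prob_cells M (fun j => g (j.+1%:R / M%:R) <= y)) => //.
move=> u [u01 /= gu]; rewrite /= in_itv /= in u01.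
have [j jM ju] := exists_cell M0 u01.
exists j; last by rewrite /= in_itv.
rewrite /= jM /=; have := near_end jM u01 ju.
by rewrite ler_norml => /andP[? ?]; lra.
Qed.

(** The complementary form of the previous bound, so that subadditivity is
    enough here too: if [g u > y + e], then g exceeds y at the right end of the
    cell of u. *)
Lemma count_le_uniform_image_df y :
  M%:R^-1 * \sum_(j < M) (g (j.+1%:R / M%:R) <= y)%R%:R <=
  uniform_image_df g (y + e).
Proof.
pose A : set R := `]0, 1[ `&` [set u | g u <= y + e].
pose B : set R := `]0, 1[ `\` A.
have mB : measurable B by apply: measurableD => //; exact: m_le.
have UB : (U01 B = (1 - uniform_image_df g (y + e))%:E)%E.
  have -> : (U01 B = U01 `]0%R, 1%R[%classic - U01 (`]0%R, 1%R[%classic `&` A))%E.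
    apply: measureD => //; first exact: m_le.
    by apply: (@le_lt_trans _ _ 1%E); [exact: probability_le1|exact: ltry].
  by rewrite setIA setIid uniform_prob_itv01 U01E.
have : (U01 B <=
  (M%:R^-1 * \sum_(j < M) (~~ (g (j.+1%:R / M%:R) <= y)%R)%:R)%:E)%E.
  apply: (@uniform_prob_cells M (fun j => ~~ (g (j.+1%:R / M%:R) <= y))) => //.
  move=> u [u01 gu]; rewrite /= in_itv /= in u01.
  have [j jM ju] := exists_cell M0 u01.
  exists j; last by rewrite /= in_itv.
  rewrite /= jM /=; apply/negP => gy; apply: gu; split => //=.
  have := near_end jM u01 ju.
  by rewrite ler_norml => /andP[? ?]; lra.
rewrite UB lee_fin.
have -> : \sum_(j < M) (~~ (g (j.+1%:R / M%:R) <= y)%R)%:R =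
   M%:R - \sum_(j < M) (g (j.+1%:R / M%:R) <= y)%R%:R :> R.
  have -> : M%:R = \sum_(j < M) 1 :> R by rewrite sumr_const card_ord.
  rewrite -sumrB; apply: eq_bigr => j _.
  by case: (g _ <= y); rewrite /= ?subrr ?subr0.
rewrite mulrBr mulVf ?pnatr_eq0 -?lt0n //; lra.
Qed.
End Count.
End UnitInterval.

(** * Concentration and bias of the smoothed counts *)

Section Finite.
Variable R : realType.

(** Pathwise form of the Chebyshev and Markov inequalities.  A cell of I whose
    Z is within eta of m has Z within [2 eta] of ga, so it is counted correctly
    up to a shift of x0 by [2 eta]; every other cell costs at most 1, which is
    paid by its membership outside I or by its normalized squared deviation. *)
Lemma count_deviation (M : nat) (Z m ga : 'I_M -> R) (I : pred 'I_M)
    (x0 eta F0 eps : R) : 0 < eta -> 0 < eps ->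
  (forall j, I j -> `|m j - ga j| <= eta) ->
  M%:R^-1 * \sum_(j < M) (~~ I j)%:R <= eps / 4 ->
  M%:R^-1 * \sum_(j < M) (ga j <= x0 + 2 * eta)%R%:R <= F0 + eps / 4 ->
  F0 - eps / 4 <= M%:R^-1 * \sum_(j < M) (ga j <= x0 - 2 * eta)%R%:R ->
  (eps < `|M%:R^-1 * \sum_(j < M) (Z j <= x0)%R%:R - F0|)%R%:R <=
  2 / eps * (M%:R^-1 * \sum_(j < M) ((Z j - m j) / eta) ^+ 2).
Proof.
move=> eta0 eps0 mga outside hi lo.
have pw j (b : bool) : (b -> I j -> eta <= `|Z j - m j|) ->
    b%:R <= (~~ I j)%:R + ((Z j - m j) / eta) ^+ 2.
  move=> bP; have sq0 := sqr_ge0 ((Z j - m j) / eta).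
  case: b bP => [/(_ isT)|_]; last by rewrite addr_ge0.
  case: (I j) => [/(_ isT) far|_] /=; last by rewrite lerDl.
  rewrite add0r -real_normK ?num_real // expr_ge1 // normrM normfV (gtr0_norm eta0).
  by rewrite ler_pdivlMr // mul1r.
have up j : (Z j <= x0)%R%:R <= (ga j <= x0 + 2 * eta)%R%:R
    + ((~~ I j)%:R + ((Z j - m j) / eta) ^+ 2).
  rewrite -lerBlDl; have [ga2|ga2] := leP (ga j) (x0 + 2 * eta).
    apply: le_trans (pw j false _) => //=.
    by case: (Z j <= x0); rewrite /= ?subrr // sub0r oppr_le0.
  rewrite subr0; apply: pw => Zx /mga.
  have := ler_norm (m j - Z j); rewrite distrC ler_norml => ? /andP[? ?]; lra.
have down j : (ga j <= x0 - 2 * eta)%R%:R <= (Z j <= x0)%R%:R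
    + ((~~ I j)%:R + ((Z j - m j) / eta) ^+ 2).
  rewrite -lerBlDl; have [Zx|Zx] := leP (Z j) x0.
    apply: le_trans (pw j false _) => //=.
    by case: (ga j <= _); rewrite /= ?subrr // sub0r oppr_le0.
  rewrite subr0; apply: pw => ga2 /mga.
  have := ler_norm (Z j - m j); rewrite ler_norml => ? /andP[? ?]; lra.
have M0 : 0 <= M%:R^-1 :> R by rewrite invr_ge0.
have := ler_wpM2l M0 (ler_sum (index_enum _) (fun j (_ : xpredT j) => up j)).
have := ler_wpM2l M0 (ler_sum (index_enum _) (fun j (_ : xpredT j) => down j)).
rewrite !big_split /= !mulrDr.
set V := M%:R^-1 * \sum_(j < M) _ ^+ 2; set Fh := _ * \sum_(j < M) (Z j <= x0)%R%:R.
move=> dn u.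
have V0 : 0 <= V by rewrite mulr_ge0 // sumr_ge0 // => j _; exact: sqr_ge0.
case: ltP => [|_] /=; last by rewrite mulr_ge0 // divr_ge0 // ltW.
rewrite mulrAC ler_pdivlMr // mul1r.
rewrite ltr_normr => /orP[] ?; lra.
Qed.

(** Weights of total mass almost 1 that concentrate on a window where q is
    almost ga average q to almost ga.  The three terms come from the window,
    from the weight outside it (at most [2 e]), and from the defect of the
    total mass. *)
Lemma weighted_mean_near (M lo hi : nat) (a : nat -> R) (q : 'I_M -> R)
    (ga D G e : R) : (hi <= M)%N -> (forall i, 0 <= a i) ->
  `|\sum_(0 <= i < M) a i - 1| <= e -> `|\sum_(lo <= i < hi) a i - 1| <= e ->
  0 <= D -> (forall i, `|q i - ga| <= D) ->
  (forall i : 'I_M, (lo <= i < hi)%N -> `|q i - ga| <= 2 * e) ->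
  `|ga| <= G ->
  `|\sum_(i < M) a i * q i - ga| <= 2 * e * (1 + e) + 2 * e * D + G * e.
Proof.
move=> hiM a0 full win D0 qD qwin gaG.
have e0 : 0 <= e := le_trans (normr_ge0 _) full.
set S := \sum_(0 <= i < M) a i in full.
set W := \sum_(lo <= i < hi) a i in win.
have SE : S = \sum_(i < M) a i by rewrite /S big_mkord.
have WE : W = \sum_(i < M) a i * (lo <= i < hi)%N%:R.
  rewrite /W (big_nat_widenl _ 0) // (big_nat_widen _ _ M) // big_mkord.
  rewrite big_mkcond; apply: eq_bigr => i _ /=.
  by rewrite andbC; case: ifP; rewrite ?mulr1 ?mulr0.
have -> : \sum_(i < M) a i * q i - ga =
    \sum_(i < M) a i * (q i - ga) + ga * (S - 1).
  have -> : \sum_(i < M) a i * (q i - ga) =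
      \sum_(i < M) a i * q i - ga * \sum_(i < M) a i.
    by rewrite mulr_sumr -sumrB; apply: eq_bigr => i _; ring.
  by rewrite SE; ring.
apply: le_trans (ler_normD _ _) _; apply: lerD; last first.
  by rewrite normrM ler_pM.
have : `|\sum_(i < M) a i * (q i - ga)| <= 2 * e * S + D * (S - W).
  rewrite SE WE mulr_sumr -sumrB mulr_sumr -big_split /=.
  apply: le_trans (ler_norm_sum _ _ _) _; apply: ler_sum => i _.
  rewrite normrM ger0_norm //.
  have -> : 2 * e * a i + D * (a i - a i * (lo <= i < hi)%N%:R) =
    a i * (2 * e + D * (1 - (lo <= i < hi)%N%:R)) by ring.
  apply: ler_wpM2l => //; case: (boolP (lo <= i < hi)%N) => [/qwin|_] /=.
    by rewrite subrr mulr0 addr0.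
  by rewrite subr0 mulr1; apply: le_trans (qD i) _; rewrite lerDr mulr_ge0.
move=> /le_trans; apply; move: full win; rewrite !ler_norml => /andP[? ?] /andP[? ?].
have : 2 * e * S <= 2 * e * (1 + e) by apply: ler_wpM2l; [rewrite mulr_ge0|lra].
have : D * (S - W) <= D * (2 * e) by apply: ler_wpM2l => //; lra.
lra.
Qed.

Lemma sum_boundary (M L : nat) :
  \sum_(j < M) (~~ ((L <= j) && (j + L < M))%N)%:R <= 2 * L%:R :> R.
Proof.
have low N : \sum_(j < N) (j < L)%N%:R <= L%:R :> R.
  have -> : \sum_(j < N) (j < L)%N%:R = (minn N L)%:R :> R.
    elim: N => [|N IHN]; first by rewrite big_ord0 min0n.
    by rewrite big_ord_recr IHN /= -natrD; congr _%:R; lia.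
  by rewrite ler_nat geq_minr.
have -> : 2 * L%:R = L%:R + L%:R :> R by ring.
apply: (@le_trans _ _ (\sum_(j < M) (j < L)%N%:R +
   \sum_(j < M) (rev_ord j < L)%N%:R)); last first.
  apply: lerD => //; have := low M.
  by rewrite (reindex_inj rev_ord_inj).
rewrite -big_split; apply: ler_sum => j _ /=.
rewrite -natrD ler_nat; have := ltn_ord j.
by case: (leqP L j); case: (ltnP (j + L) M); case: ltnP => //=; lia.
Qed.

(** One factor a of the variance is replaced by its bound C; the other one is
    summed. *)
Lemma kernel_mean_square_le (n M : nat) (p : 'I_M -> R) (k C G B : R)
    (a : 'I_M -> R) :
  (0 < n)%N -> (0 < M)%N -> 0 < k -> (forall i, 0 <= p i) ->
  \sum_(i < M) p i = 1 ->
  (forall i, 0 <= a i <= C) -> (forall i, M%:R * p i <= G) ->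
  \sum_(i < M) a i / k <= B -> 0 <= B ->
  draw_mean p n (fun x =>
    (M%:R / (n%:R * k) * \sum_(i < M) a i * (x i)%:R -
     \sum_(i < M) a i / k * (M%:R * p i)) ^+ 2) <=
  M%:R / (n%:R * k) * (C * G * B).
Proof.
move=> n0 M0 k0 p0 p1 aC pG aB B0.
have nR : 0 < n%:R :> R by rewrite ltr0n.
have MR : 0 < M%:R :> R by rewrite ltr0n.
pose mu := \sum_(i < M) p i * a i.
have -> : (fun x : 'I_M -> nat =>
    (M%:R / (n%:R * k) * \sum_(i < M) a i * (x i)%:R -
     \sum_(i < M) a i / k * (M%:R * p i)) ^+ 2) =
   (fun x => (M%:R / (n%:R * k)) ^+ 2 *
     (\sum_(i < M) a i * (x i)%:R - n%:R * mu) ^+ 2).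
  apply/funext => x; rewrite -exprMn; congr (_ ^+ 2).
  rewrite mulrBr; congr (_ - _); rewrite /mu !mulr_sumr; apply: eq_bigr => i _.
  by field; rewrite !gt_eqF.
rewrite draw_meanZ.
have varle := @draw_mean_square_le R M p p1 a mu n erefl.
apply: le_trans (ler_wpM2l (sqr_ge0 _) varle) _.
have C0 : 0 <= C by have /andP[/le_trans] := aC (Ordinal M0); apply.
have sumle : \sum_(i < M) p i * a i ^+ 2 <= C * G * B * (k / M%:R).
  have G0 : 0 <= G.
    by apply: le_trans (pG (Ordinal M0)); rewrite mulr_ge0 // ltW.
  apply: (@le_trans _ _ (\sum_(i < M) C * G * (k / M%:R) * (a i / k))).
    apply: ler_sum => i _; have /andP[a0 aCi] := aC i.
    have -> : C * G * (k / M%:R) * (a i / k) = G / M%:R * (C * a i).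
      by field; rewrite !gt_eqF.
    apply: ler_pM => //; first exact: sqr_ge0.
      by rewrite ler_pdivlMr // mulrC.
    by rewrite expr2 ler_wpM2r.
  have -> : C * G * B * (k / M%:R) = C * G * (k / M%:R) * B by ring.
  rewrite -mulr_sumr.
  by apply: ler_wpM2l => //; rewrite mulr_ge0 ?divr_ge0 ?mulr_ge0 // ltW.
apply: le_trans (ler_wpM2l (sqr_ge0 _) (ler_wpM2l (ltW nR) sumle)) _.
rewrite le_eqVlt; apply/orP; left; apply/eqP.
by field; rewrite !gt_eqF.
Qed.
End Finite.

(** * Consistency *)

(** The cells are closed on the right, so the right end belongs to the cell of
    index i. *)
Lemma parent_density_right_end (R : realType) (M : nat) (p : 'I_M -> R)
    (i : 'I_M) : parent_density p (i.+1%:R / M%:R) = M%:R * p i.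
Proof.
have M0 : (0 < M)%N := leq_ltn_trans (leq0n i) (ltn_ord i).
have MR : 0 < M%:R^-1 :> R by rewrite invr_gt0 ltr0n.
rewrite /parent_density (bigD1 i) //= big1 ?addr0 => [|l li].
  by rewrite indicE mem_set ?mulr1 //= in_itv /= ltr_pM2r // ltr_nat ltnSn lexx.
rewrite indicE memNset ?mulr0 //= in_itv /= ltr_pM2r // ler_pM2r //.
by rewrite ltr_nat ler_nat ltnS -eqn_leq => /eqP/val_inj/eqP; rewrite (negPf li).
Qed.

Lemma window_bounds (L j M : nat) : (L <= j)%N -> (j + L < M)%N ->
  [/\ (j - L <= j < j + L.+1)%N, (j + L.+1 <= M)%N, (L <= j.+1 - 0)%N,
      (L <= M - j)%N & ((L <= j.+1 - (j - L)) && (L <= j + L.+1 - j))%N].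
Proof. by move=> Lj jL; split; lia. Qed.

Lemma mem_window (L i j : nat) : (j - L <= i < j + L.+1)%N ->
  ((i <= j + L) && (j <= i + L))%N.
Proof. lia. Qed.

Lemma kernel_bias_le (R : realType) (M L : nat) (j : 'I_M) (p : 'I_M -> R)
    (w g : R -> R) (k G d e : R) :
  (L <= j)%N -> (j + L < M)%N -> 0 < k -> (forall x, 0 <= w x) -> e <= 1 ->
  `|\sum_(0 <= i < M) w ((j%:R - i%:R) / k) / k - 1| <= e ->
  `|\sum_(j - L <= i < j + L.+1) w ((j%:R - i%:R) / k) / k - 1| <= e ->
  (forall x : R, 0 <= x <= 1 -> 0 <= g x <= G) ->
  (forall x y : R, 0 <= x <= 1 -> 0 <= y <= 1 -> `|x - y| <= d ->
     `|g x - g y| <= e) ->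
  L%:R / M%:R <= d ->
  (forall i : 'I_M, `|M%:R * p i - g (i.+1%:R / M%:R)| <= e) ->
  `|\sum_(i < M) w ((j%:R - i%:R) / k) / k * (M%:R * p i)
    - g (j.+1%:R / M%:R)| <=
  2 * e * (1 + e) + 2 * e * (2 * G + 1) + G * e.
Proof.
move=> Lj jL k0 w0 e1 full win gG guc LM pg.
have M0 : 0 < M%:R :> R by rewrite ltr0n (leq_ltn_trans (leq0n j)).
have jLM : (j + L.+1 <= M)%N by rewrite addnS.
have cell01 (i : 'I_M) : 0 <= (i.+1%:R : R) / M%:R <= 1.
  by rewrite divr_ge0 //= ler_pdivrMr // mul1r ler_nat.
have /andP[gj0 gjG] := gG _ (cell01 j).
have a0 (i : nat) : 0 <= w ((j%:R - i%:R) / k) / k by rewrite divr_ge0 // ltW.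
apply: (weighted_mean_near jLM a0 full win); last by rewrite ger0_norm.
- lra.
- move=> i; have /andP[? ?] := gG _ (cell01 i); have := pg i.
  by rewrite !ler_norml => /andP[? ?]; apply/andP; split; lra.
move=> i /mem_window iL.
have gij : `|g (i.+1%:R / M%:R) - g (j.+1%:R / M%:R)| <= e.
  apply: guc => //; apply: le_trans LM.
  rewrite -mulrBl normrM [X in _ * X]ger0_norm ?invr_ge0 // ler_pM2r ?invr_gt0 //.
  move: iL; rewrite -!(ler_nat R) !natrD -!natr1 ler_norml => /andP[? ?].
  by apply/andP; split; lra.
apply: le_trans (ler_distD (g (i.+1%:R / M%:R)) _ _) _.
have -> : 2 * e = e + e by ring.
exact: lerD.
Qed.

(** Everything quantitative for one fixed n: the probability is of the order
    of [M/(nk)]. *)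
Lemma kernel_df_deviation_le (R : realType) (d : measure_display)
    (T : measurableType d) (P : probability T R) (n M : nat) (p : 'I_M -> R)
    (X : 'I_M -> {RV P >-> nat}) (w : R -> R) (k C G B eta eps F0 x0 : R)
    (ga : 'I_M -> R) (I : pred 'I_M) :
  (0 < n)%N -> (0 < M)%N -> 0 < k -> (forall i, 0 <= p i) ->
  \sum_(i < M) p i = 1 -> is_multinomial n p X ->
  (forall x, 0 <= w x <= C) -> (forall i, M%:R * p i <= G) -> 0 <= B ->
  (forall j : 'I_M, \sum_(i < M) w ((j%:R - i%:R) / k) / k <= B) ->
  0 < eta -> 0 < eps ->
  (forall j, I j -> `|\sum_(i < M) w ((j%:R - i%:R) / k) / k * (M%:R * p i)
                      - ga j| <= eta) ->
  M%:R^-1 * \sum_(j < M) (~~ I j)%:R <= eps / 4 ->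
  M%:R^-1 * \sum_(j < M) (ga j <= x0 + 2 * eta)%R%:R <= F0 + eps / 4 ->
  F0 - eps / 4 <= M%:R^-1 * \sum_(j < M) (ga j <= x0 - 2 * eta)%R%:R ->
  (P [set t | (eps < `|kernel_df w k n (fun i => X i t) x0 - F0|)%R] <=
   (2 / eps * (eta ^- 2 * (C * G * B)) * (M%:R / (n%:R * k)))%:E)%E.
Proof.
move=> n0 M0 k0 p0 p1 Xp wC pG B0 wB eta0 eps0 bias outside hi lo.
have := multinomial_prob_le p0 p1 Xp
  (fun x => eps < `|kernel_df w k n x x0 - F0|).
move=> /le_trans; apply; rewrite lee_fin.
pose Z (j : 'I_M) (x : 'I_M -> nat) :=
  M%:R / (n%:R * k) * \sum_(i < M) w ((j%:R - i%:R) / k) * (x i)%:R.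
pose m (j : 'I_M) := \sum_(i < M) w ((j%:R - i%:R) / k) / k * (M%:R * p i).
apply: (@le_trans _ _ (draw_mean p n (fun x => 2 / eps *
   (M%:R^-1 * \sum_(j < M) ((Z j x - m j) / eta) ^+ 2)))).
  apply: ler_draw_mean => // x _.
  exact: (@count_deviation R M (Z^~ x) m ga I x0 eta F0 eps).
have c0 : 0 <= 2 / eps by rewrite divr_ge0 // ltW.
rewrite draw_meanZ -mulrA; apply: ler_wpM2l => //.
rewrite draw_meanZ draw_mean_sum ler_pdivrMl ?ltr0n //.
have -> (c : R) : M%:R * c = \sum_(j < M) c by rewrite sumr_const card_ord mulr_natl.
apply: ler_sum => j _.
have -> : (fun x => ((Z j x - m j) / eta) ^+ 2) =
    (fun x => eta ^- 2 * (Z j x - m j) ^+ 2).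
  by apply/funext => x; rewrite exprMn exprVn mulrC.
rewrite draw_meanZ -mulrA [X in _ <= X]mulrA -mulrA; apply: ler_wpM2l.
  by rewrite invr_ge0 sqr_ge0.
rewrite [X in _ <= X]mulrC.
by apply: (@kernel_mean_square_le R n M p k C G B
  (fun i => w ((j%:R - i%:R) / k))).
Qed.

Theorem theorem5p2 (R : realType) (d : nat -> measure_display)
  (T : forall n, measurableType (d n)) (P : forall n, probability (T n) R)
  (M : nat -> nat) (p : forall n, 'I_(M n) -> R)
  (X : forall n, 'I_(M n) -> {RV (P n) >-> nat})
  (k : nat -> R) (w g : R -> R)
  (M_ge1 : forall n, (1 <= M n)%N)
  (M_rate : ~ ((M n)%:R / n%:R : R) @[n --> \oo] --> (0 : R))
  (p_ge0 : forall n i, 0 <= p n i)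
  (p_sum1 : forall n, \sum_(i < M n) p n i = 1)
  (X_multinomial : forall n, is_multinomial n (p n) (X n))
  (k_gt0 : forall n, 0 < k n)
  (w_density : is_density setT w)
  (k_infty : k n @[n --> \oo] --> +oo)
  (k_over_M : k n / (M n)%:R @[n --> \oo] --> (0 : R))
  (M_over_nk : (M n)%:R / (n%:R * k n) @[n --> \oo] --> (0 : R))
  (w_integrable : forall a b : R, a <= b -> riemann_integrable w a b)
  (w_square_integrable :
     forall a b : R, a <= b -> riemann_integrable (fun x => w x ^+ 2) a b)
  (w_tails : bounded_support w \/ ultimately_monotone w)
  (g_density : is_density `[0, 1] g)
  (g_continuous : {within `[0, 1], continuous g})
  (g_limit :
     ereal_sup [set `|parent_density (p n) u - g u|%:E | u in `]0, 1]]
       @[n --> \oo] --> 0%E) :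
  weak_cvg_in_probability P
    (fun n t => kernel_df w (k n) n (fun i => X n i t))
    (uniform_image_df g).
Proof.
have w0 x : 0 <= w x by case: w_density => _ + _; apply.
move=> eps x0 eps0 Fx0.
set F0 := uniform_image_df g x0.
have MR n : 0 < (M n)%:R :> R by rewrite ltr0n M_ge1.
have [C C0 wC] := density_bounded w_density w_integrable w_tails.
have [G G0 gG] := unit_density_bounded g_continuous g_density.
have [eta eta0 [Fhi Flo]] : exists2 eta, 0 < eta &
    uniform_image_df g (x0 + 3 * eta) <= F0 + eps / 4 /\
    F0 - eps / 4 <= uniform_image_df g (x0 - 3 * eta).
  have /cvgrPdist_le/(_ (eps / 4)) := Fx0; rewrite divr_gt0 // => /(_ isT).
  rewrite near_simpl => -[r /= r0 rP].
  have r40 : 0 < r / 4 by rewrite divr_gt0.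
  exists (r / 4) => //; split.
    have /= := rP (x0 + 3 * (r / 4)).
    rewrite opprD addrA subrr sub0r normrN ger0_norm; last lra.
    by move=> /(_ ltac:(lra)); rewrite -/F0 ler_norml => /andP[? ?]; lra.
  have /= := rP (x0 - 3 * (r / 4)).
  rewrite opprB addrC subrK ger0_norm; last lra.
  by move=> /(_ ltac:(lra)); rewrite -/F0 ler_norml => /andP[? ?]; lra.
(* e is the tolerance for the weights, for g_M - g and for the oscillation of
   g on a window; together these errors stay below eta. *)
have [e [e0 e1 e_eta]] : exists e, [/\ 0 < e, e <= 1 &
    2 * e * (1 + e) + 2 * e * (2 * G + 1) + G * e <= eta].
  have c0 : 0 < 6 + 5 * G by lra.
  exists (Num.min 1 (eta / (6 + 5 * G))); set e := Num.min _ _.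
  have e0 : 0 < e by rewrite lt_min ltr01 divr_gt0.
  have e1 : e <= 1 by rewrite ge_min lexx.
  have : e * (6 + 5 * G) <= eta by rewrite -ler_pdivlMr // ge_min lexx orbT.
  split => //; have : e * e <= e by rewrite ler_piMl // ltW.
  lra.
have [A A0 [h1 h10 Hnear]] := kernel_sum_near w_density w_integrable w_tails e0.
have [h2 h20 Hbound] := kernel_sum_bounded w_density w_integrable w_tails.
have [d1 d10 guc1] := unit_uniform_continuous g_continuous e0.
have [d2 d20 guc2] := unit_uniform_continuous g_continuous eta0.
pose r n : R := (M n)%:R / (n%:R * k n).
pose K := 2 / eps * (eta ^- 2 * (C * (G + 1) * 4)).
apply: (@squeeze_cvge _ _ _ _ (fun=> 0%E) _ (fun n => (K * r n)%:E)); last 2 first.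
- exact: cvg_cst.
- have : K * r n @[n --> \oo] --> K * 0 by apply: cvgMr.
  rewrite mulr0 => cv; apply: cvg_EFin => //; exact: nearW.
have A10 : 0 < A + 1 by lra.
pose c := Num.min (Num.min (d1 / (A + 1)) d2) (eps / (8 * (A + 1))).
have c0 : 0 < c by rewrite !lt_min d20 !divr_gt0 // mulr_gt0.
have k_le n : `|0 - k n / (M n)%:R| = k n / (M n)%:R.
  by rewrite sub0r normrN ger0_norm // divr_ge0 // ltW.
have kM : \forall n \near \oo, k n / (M n)%:R <= c.
  by move/cvgrPdist_le : k_over_M => /(_ c c0); under eq_near do rewrite k_le.
have kbig B : \forall n \near \oo, B <= k n by move/cvgryPge: k_infty; apply.
have gsup : \forall n \near \oo, forall i : 'I_(M n),
    `|(M n)%:R * p n i - g (i.+1%:R / (M n)%:R)| <= e.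
  have /fine_cvgP[fin /cvgrPdist_le/(_ e e0)] := g_limit.
  apply: filter_app2 fin; near=> n => fin; rewrite sub0r normrN => sup i.
  set S := ereal_sup _ in fin sup.
  have : (`|parent_density (p n) (i.+1%:R / (M n)%:R) - g (i.+1%:R / (M n)%:R)|%:E <= S)%E.
    apply: ereal_sup_ubound; exists (i.+1%:R / (M n)%:R) => //=.
    by rewrite in_itv /= divr_gt0 ?ltr0n //= ler_pdivrMr // mul1r ler_nat.
  rewrite parent_density_right_end -(fineK fin) lee_fin => /le_trans; apply.
  exact: le_trans (ler_norm _) sup.
near=> n.
have kn1 : 1 <= k n by near: n; exact: kbig.
have kh1 : 2 / h1 <= k n by near: n; exact: kbig.
have kh2 : 2 / h2 <= k n by near: n; exact: kbig.
have n0 : (0 < n)%N by near: n; exact: nbhs_infty_gt.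
have kMn : k n / (M n)%:R <= c by near: n.
have gn : forall i : 'I_(M n),
    `|(M n)%:R * p n i - g (i.+1%:R / (M n)%:R)| <= e by near: n.
have k0 := k_gt0 n; have M0 := MR n.
pose h := (k n)^-1.
have h0 : 0 < h by rewrite invr_gt0.
have hh h' : 0 < h' -> 2 / h' <= k n -> h < h'.
  move=> h'0 le2; rewrite -[h']invrK ltf_pV2 ?posrE ?invr_gt0 //.
  by apply: lt_le_trans le2; rewrite ltr_pMl ?invr_gt0 // ltr1n.
have hle1 : 0 < h < h1 by rewrite h0 hh.
have hle2 : 0 < h < h2 by rewrite h0 hh.
have kM1 : (A + 1) * (k n / (M n)%:R) <= d1.
  by rewrite mulrC -ler_pdivlMr //; apply: le_trans kMn _; rewrite !ge_min lexx.
have kM2 : k n / (M n)%:R <= d2.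
  by apply: le_trans kMn _; rewrite !ge_min lexx orbT.
have kM3 : (A + 1) * (k n / (M n)%:R) <= eps / 8.
  have : k n / (M n)%:R <= eps / (8 * (A + 1)).
    by apply: le_trans kMn _; rewrite !ge_min lexx orbT.
  rewrite ler_pdivlMr ?mulr_gt0 // => H; lra.
(* The half-width of the window is the least L with A <= L / k, hence at most
   (A + 1) k. *)
have [N NA AN] := exists_step A0 h0.
pose L := N.+1.
have LM : L%:R / (M n)%:R <= (A + 1) * (k n / (M n)%:R).
  rewrite mulrA ler_pM2r ?invr_gt0 // /L -natr1.
  by move: NA; rewrite /h ltr_pdivrMr // => NA; lra.
have cell01 (j : 'I_(M n)) : 0 <= (j.+1%:R : R) / (M n)%:R <= 1.
  by rewrite divr_ge0 //= ler_pdivrMr // mul1r ler_nat.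
pose I (j : 'I_(M n)) := ((L <= j) && (j + L < M n))%N.
have invM : (M n)%:R^-1 <= d2.
  by apply: le_trans kM2; rewrite ler_peMl ?invr_ge0.
have guc2' x y : 0 <= x <= 1 -> 0 <= y <= 1 -> `|x - y| <= (M n)%:R^-1 ->
    `|g x - g y| <= eta.
  by move=> x01 y01 xy; apply: guc2 => //; exact: le_trans invM.
rewrite measure_ge0 /=.
apply: (@kernel_df_deviation_le R _ _ (P n) n (M n) (p n) (X n) w (k n) C (G + 1) 4 eta
  eps F0 x0 (fun j => g (j.+1%:R / (M n)%:R)) I) => //.
- by move=> x; rewrite w0 wC.
- move=> i; have := gn i; have /andP[? ?] := gG _ (cell01 i).
  by rewrite ler_norml => /andP[? ?]; lra.
- move=> j; have := Hbound h 0%N j (M n) hle2 (ltn_ord j).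
  by rewrite big_mkord.
- move=> j /andP[Lj jL].
  have jin : (0 <= j < M n)%N by rewrite ltn_ord.
  have [win jLM L1 L2 /andP[L3 L4]] := window_bounds Lj jL.
  have long m : (L <= m)%N -> A <= m%:R * h.
    by move=> Lm; apply: le_trans AN _; rewrite ler_pM2r // ler_nat.
  apply: le_trans e_eta.
  apply: (kernel_bias_le Lj jL k0 w0 e1 _ _ gG guc1) => //.
  + by apply: (Hnear h 0%N j (M n)) => //; exact: long.
  + by apply: (Hnear h _ j _ hle1 win); exact: long.
  + exact: le_trans kM1.
- apply: le_trans (ler_wpM2l _ (sum_boundary _ _ _)) _; first by rewrite invr_ge0.
  by rewrite mulrC -mulrA; lra.
- apply: le_trans (count_le_uniform_image_df g_density (M_ge1 n) guc2' _) _.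
  by rewrite (_ : _ + _ = x0 + 3 * eta) //; lra.
- apply: le_trans Flo _.
  rewrite (_ : x0 - 3 * eta = x0 - 2 * eta - eta); last lra.
  exact: (uniform_image_df_le_count g_density (M_ge1 n) guc2' (x0 - 2 * eta)).
Unshelve. all: by end_near. Qed.
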